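(* Let $(A,\mathfrak m)$ be an analytically unramified Cohen-Macaulay local ring of dimension $d\geq 1$. Let $I$ be an $\mathfrak m$-primary ideal and let $\mathcal F=\{I_n\}_{n\in\mathbb Z}$ be an $I$-admissible filtration with $I_1=\overline I$ and $I_n=\overline{I^n}$ for all $n\gg 0$. Let $M,N$ be maximal Cohen-Macaulay $A$-modules. Then $T_{\mathcal F}(M,N)$ is a submodule of $\operatorname{Ext}^1_A(M,N)$.
   Context: $A$ is analytically unramified if its $\mathfrak m$-adic completion is reduced. $\overline{\mathfrak a}$ denotes the integral closure of an ideal $\mathfrak a$. MCM means maximal Cohen-Macaulay. A filtration $\mathcal F=\{F_n\}_{n\in\mathbb Z}$ of ideals of $A$ is $I$-admissible if $I^n\subseteq F_n$ for all $n$, $F_nF_m\subseteq F_{n+m}$ for all $n,m$, and $F_n=IF_{n-1}$ for $n\gg0$. For an MCM $A$-module $M$ set $$e^T_{\mathcal F}(M)=\lim_{n\to\infty}\frac{(d-1)!}{n^{d-1}}\,\ell\bigl(\operatorname{Tor}^A_1(M,A/I_{n+1})\bigr).$$ For $\alpha\in\operatorname{Ext}^1_A(M,N)$ represented by $0\to N\to E\to M\to 0$ (with $M,N$, hence $E$, MCM) set $e^T_{\mathcal F}(\alpha)=e^T_{\mathcal F}(M)+e^T_{\mathcal F}(N)-e^T_{\mathcal F}(E)\ge 0$. The extension $\alpha$ is $T_{\mathcal F}$-split if $e^T_{\mathcal F}(\alpha)=0$, and $T_{\mathcal F}(M,N)$ is the subset of $\operatorname{Ext}^1_A(M,N)$ consisting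 of all $T_{\mathcal F}$-split extensions. *)

(* Defs.v *)
From HB Require Import structures.
From mathcomp Require Import all_boot all_order all_algebra.
From mathcomp Require Import generic_quotient ring_quotient.
From mathcomp.multinomials Require Import freeg.
From mathcomp Require Import all_classical all_reals all_analysis.

Set Implicit Arguments.
Unset Strict Implicit.
Unset Printing Implicit Defensive.

Import Order.TTheory GRing.Theory Num.Theory.
Import numFieldNormedType.Exports.

Local Open Scope classical_set_scope.
Local Open Scope ring_scope.
Local Open Scope quotient_scope.

(** * Submodules and quotient modules *)

Section Submodules.
Variables (A : comPzRingType) (V : lmodType A).
Implicit Type S : set V.

Definition is_submod S : Prop :=
  [/\ S 0, forall x y, S x -> S y -> S (x + y) & forall a x, S x -> S (a *: x)].

Definition lspan S : set V := smallest is_submod S.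

Lemma lspan_is_submod S : is_submod (lspan S).
Proof.
split=> [W [[]]//|x y Sx Sy W SW|a x Sx W SW]; have [[_ WD WZ] _] := SW.
  by apply: WD; [exact: Sx|exact: Sy].
by apply: WZ; exact: Sx.
Qed.

Definition lspan_pred S : {pred V} := fun x => `[< lspan S x >].

Lemma lspan_pred_closed S : submod_closed (lspan_pred S).
Proof.
have [S0 SD SZ] := lspan_is_submod S.
split=> [|a x y /asboolP Sx /asboolP Sy]; apply/asboolP => //.
by apply: SD => //; apply: SZ.
Qed.

HB.instance Definition _ S :=
  GRing.isSubmodClosed.Build A V (lspan_pred S) (lspan_pred_closed S).

(* The submodule generated by S, as a module; S itself when S is a submodule. *)
Definition submod S : Type := {x : V | x \in lspan_pred S}.

HB.instance Definition _ S := SubChoice.on (submod S).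
HB.instance Definition _ S := [SubChoice_isSubLmodule of submod S by <:].

(* The quotient of V by the submodule generated by S; V / S when S is a
   submodule. *)
Definition quotmod S : Type := Quotient.quot (lspan_pred S).

HB.instance Definition _ S := Quotient.on (quotmod S).
HB.instance Definition _ S := GRing.Zmodule.on (quotmod S).
HB.instance Definition _ S :=
  EqQuotient.on (quotmod S : eqQuotType (Quotient.equiv (lspan_pred S))).
HB.instance Definition _ S :=
  ZmodQuotient.on (quotmod S : zmodQuotType (Quotient.equiv (lspan_pred S)) 0 -%R +%R).

Definition quotmod_scale S (a : A) : quotmod S -> quotmod S :=
  fun x => \pi_(quotmod S) (a *: repr x).

Lemma quotmod_eqP S x y :
  reflect (\pi_(quotmod S) x = \pi_(quotmod S) y) (x - y \in lspan_pred S).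
Proof. by rewrite Quotient.idealrBE; exact: eqP. Qed.

Lemma pi_quotmod_scale S a x :
  \pi_(quotmod S) (a *: x) = quotmod_scale a (\pi_(quotmod S) x).
Proof.
apply/eqP; rewrite -Quotient.idealrBE -scalerBr rpredZ //.
by rewrite Quotient.idealrBE reprK.
Qed.

Fact quotmod_scaleA S a b (x : quotmod S) :
  quotmod_scale a (quotmod_scale b x) = quotmod_scale (a * b) x.
Proof.
elim/quotW: x => x.
by rewrite -(pi_quotmod_scale S b) -!pi_quotmod_scale scalerA.
Qed.

Fact quotmod_scale1 S : left_id 1 (@quotmod_scale S).
Proof. by elim/quotW => x; rewrite -pi_quotmod_scale scale1r. Qed.

Fact quotmod_scaleDr S : right_distributive (@quotmod_scale S) +%R.
Proof.
move=> a; elim/quotW => x; elim/quotW => y.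
rewrite -pi_addr -(pi_quotmod_scale S a x) -(pi_quotmod_scale S a y).
by rewrite -pi_quotmod_scale -pi_addr scalerDr.
Qed.

Fact quotmod_scaleDl S (x : quotmod S) :
  {morph (@quotmod_scale S)^~ x : a b / a + b}.
Proof.
move=> a b; elim/quotW: x => x.
rewrite -(pi_quotmod_scale S a x) -(pi_quotmod_scale S b x).
by rewrite -pi_quotmod_scale -pi_addr scalerDl.
Qed.

HB.instance Definition _ S := GRing.Zmodule_isLmodule.Build A (quotmod S)
  (@quotmod_scaleA S) (@quotmod_scale1 S) (@quotmod_scaleDr S)
  (@quotmod_scaleDl S).

End Submodules.

Definition smul (A : comPzRingType) (V : lmodType A) (I : set A) (X : set V) :
  set V := lspan [set a *: x | a in I & x in X].

Definition fingen (A : comPzRingType) (V : lmodType A) (X : set V) : Prop :=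
  exists s : seq V, X = lspan [set` s].

(* The subquotient Z / B, for submodules B `<=` Z of V. *)
Definition subquot (A : comPzRingType) (V : lmodType A) (Z B : set V) :
  lmodType A := quotmod [set z : submod Z | B (val z)].

(** * Ideals *)

Section Ideals.
Variable A : comPzRingType.
Implicit Types I J p : set A.

Definition is_ideal I : Prop := @is_submod A A^o I.

Definition ideal_mul I J : set A := @smul A A^o I J.

Definition ideal_exp I (n : nat) : set A := iter n (ideal_mul I) setT.

(* I ^ n = A for n <= 0 *)
Definition ideal_expz I (n : int) : set A :=
  if n is Posz k then ideal_exp I k else setT.

Definition radical I : set A := [set x | exists n, I (x ^+ n)].

Definition prime_ideal p : Prop :=
  [/\ is_ideal p, ~ p 1 & forall x y, p (x * y) -> p x \/ p y].

Definition primary_ideal I : Prop :=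
  [/\ is_ideal I, ~ I 1 & forall x y, I (x * y) -> I x \/ radical I y].

Definition primary_to p I : Prop := primary_ideal I /\ radical I = p.

Definition maximal_ideal p : Prop :=
  [/\ is_ideal p, ~ p 1 & forall J, is_ideal J -> ~ J 1 -> p `<=` J -> J = p].

(* x ^ n + c_1 x ^ (n - 1) + ... + c_n = 0 with c_i in I ^ i *)
Definition integral_closure I : set A :=
  [set x | exists (n : nat) (c : nat -> A),
    [/\ (0 < n)%N,
        forall i, (1 <= i <= n)%N -> ideal_exp I i (c i) &
        x ^+ n + \sum_(1 <= i < n.+1) c i * x ^+ (n - i) = 0]].

Definition noetherian : Prop := forall I, is_ideal I -> @fingen A A^o I.

Definition prime_chain (n : nat) : Prop := exists p : nat -> set A,
  (forall i, (i <= n)%N -> prime_ideal (p i)) /\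
  (forall i, (i < n)%N -> p i `<` p i.+1).

Definition krull_dim (d : nat) : Prop :=
  prime_chain d /\ forall n, prime_chain n -> (n <= d)%N.

Definition noetherian_local (m : set A) : Prop :=
  noetherian /\ (forall p, maximal_ideal p <-> p = m).

(* In a filtration of ideals, F_(n+1) is contained in F_n; here this follows
   from F_(-1) = A and F_(-1) F_(n+1) `<=` F_n. *)
Definition admissible I (F : int -> set A) : Prop :=
  [/\ forall n, is_ideal (F n),
      forall n, ideal_expz I n `<=` F n,
      forall n k, ideal_mul (F n) (F k) `<=` F (n + k) &
      \forall n \near \oo, F n%:Z = ideal_mul I (F (n%:Z - 1))].

End Ideals.

(** * Completion *)

Section QuotientRing.
Variables (A : comPzRingType) (S : set A).

(* The quotient of the ring A by the ideal generated by S. *)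
Definition quotring : Type := @quotmod A A^o S.

HB.instance Definition _ := GRing.Zmodule.on quotring.

Local Notation pi := (\pi_(@quotmod A A^o S) : A -> quotring).

Definition quotring_one : quotring := pi 1.
Definition quotring_mul (x y : quotring) : quotring :=
  pi ((repr x : A) * (repr y : A)).

Lemma quotring_piM (x y : A) : pi (x * y) = quotring_mul (pi x) (pi y).
Proof.
have piE (z t : A) : (z - t \in @lspan_pred A A^o S) = (pi z == pi t).
  exact: (@Quotient.idealrBE A^o (@lspan_pred A A^o S) z t).
have rZ (u z t : A) : pi z = pi t -> pi (u * z) = pi (u * t).
  move=> /eqP; rewrite -piE => zt; apply/eqP; rewrite -piE -mulrBr.
  exact: (@rpredZ A A^o (@lspan_pred A A^o S) u).
have rK (z : A) : pi z = pi (repr (pi z)) by rewrite reprK.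
rewrite /quotring_mul (rZ _ _ _ (rK y)) mulrC (rZ _ _ _ (rK x)).
by rewrite mulrC.
Qed.

Fact quotring_mulA : associative quotring_mul.
Proof.
elim/quotW => x; elim/quotW => y; elim/quotW => z.
by rewrite -(quotring_piM y) -(quotring_piM x y) -!quotring_piM mulrA.
Qed.

Fact quotring_mulC : commutative quotring_mul.
Proof.
by elim/quotW => x; elim/quotW => y; rewrite -!quotring_piM mulrC.
Qed.

Fact quotring_mul1 : left_id quotring_one quotring_mul.
Proof. by elim/quotW => x; rewrite -quotring_piM mul1r. Qed.

Fact quotring_mulDl : left_distributive quotring_mul +%R.
Proof.
elim/quotW => x; elim/quotW => y; elim/quotW => z.
rewrite -pi_addr -(quotring_piM x z) -(quotring_piM y z) -quotring_piM.
by rewrite -pi_addr mulrDl.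
Qed.

HB.instance Definition _ := GRing.Zmodule_isComPzRing.Build quotring
  quotring_mulA quotring_mulC quotring_mul1 quotring_mulDl.

End QuotientRing.

Section Completion.
Variables (A : comPzRingType) (m : set A).

Lemma ideal_exp_is_ideal n : is_ideal (ideal_exp m n).
Proof. by case: n => [|n]; [|exact: lspan_is_submod]. Qed.

Definition coherent_pred : {pred nat -> A} :=
  fun a => `[< forall n, ideal_exp m n (a n.+1 - a n) >].

Lemma coherent_pred_closed : subring_closed coherent_pred.
Proof.
have mD n := let: And3 _ h _ := ideal_exp_is_ideal n in h.
have mZ n := let: And3 _ _ h := ideal_exp_is_ideal n in h.
split=> [|a b /asboolP ha /asboolP hb|a b /asboolP ha /asboolP hb].
- by apply/asboolP => n; rewrite subrr; case: (ideal_exp_is_ideal n).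
- apply/asboolP => n.
  have -> : (a - b) n.+1 - (a - b) n
      = (a n.+1 - a n) + (-1 : A) * (b n.+1 - b n).
    by rewrite mulN1r !fctE !opprB addrACA [RHS]addrACA [- a n + _]addrC.
  by apply: mD => //; apply: mZ.
- apply/asboolP => n.
  have -> : (a * b) n.+1 - (a * b) n
      = a n.+1 * (b n.+1 - b n) + b n * (a n.+1 - a n).
    by rewrite !fctE /= !mulrBr addrA [b n * a n.+1]mulrC subrK [b n * a n]mulrC.
  by apply: mD; apply: mZ.
Qed.

HB.instance Definition _ :=
  GRing.isSubringClosed.Build (nat -> A) coherent_pred coherent_pred_closed.

(* Sequences with a_(n+1) = a_n modulo m ^ n. *)
Definition coherent : Type := {a : nat -> A | a \in coherent_pred}.

HB.instance Definition _ := SubChoice.on coherent.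
HB.instance Definition _ := GRing.SubChoice_isSubComPzRing.Build (nat -> A)
  coherent_pred coherent (subringClosedP _).

(* The inverse limit of the rings A / m ^ n, as the ring of coherent sequences
   modulo the ideal of those with a_n in m ^ n for all n. *)
Definition completion : comPzRingType :=
  quotring [set a : coherent | forall n, ideal_exp m n (val a n)].

End Completion.

Definition reduced_ring (A : comPzRingType) : Prop :=
  forall (x : A) n, x ^+ n = 0 -> x = 0.

Definition analytically_unramified (A : comPzRingType) (m : set A) : Prop :=
  reduced_ring (completion m).

(** * Length, depth and Cohen-Macaulay modules *)

Section Modules.
Variables (A : comPzRingType) (V : lmodType A).

Definition submod_chain (n : nat) : Prop := exists W : nat -> set V,
  (forall i, (i <= n)%N -> is_submod (W i)) /\
  (forall i, (i < n)%N -> W i `<` W i.+1).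

Definition module_length (R : realType) : \bar R :=
  ereal_sup [set (n%:R : R)%:E | n in submod_chain].

Definition regular_seq (s : seq A) : Prop :=
  let sV i := smul [set` take i s] [set: V] in
  (forall i, (i < size s)%N -> forall x : V, sV i (s`_i *: x) -> sV i x) /\
  sV (size s) <> setT.

Definition depth (m : set A) (n : nat) : Prop :=
  (exists s, [/\ size s = n, [set` s] `<=` m & regular_seq s]) /\
  (forall s, [set` s] `<=` m -> regular_seq s -> (size s <= n)%N).

(* The condition on the depth forces V <> 0. *)
Definition maximal_cohen_macaulay (m : set A) : Prop :=
  fingen [set: V] /\ exists d, krull_dim A d /\ depth m d.

End Modules.

Definition cohen_macaulay (A : comPzRingType) (m : set A) : Prop :=
  exists d, krull_dim A d /\ @depth A A^o m d.

(** * Free resolutions, Tor_1 and Ext^1 *)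

(* The basis element of {freeg X / A} given by x : X. *)
Definition free_gen (A : comNzRingType) (X : choiceType) (x : X) : {freeg X / A} :=
  Freeg [:: (1, x)].

Section Resolution.
Variables (A : comNzRingType) (M : lmodType A).

(* The beginning  res2 -d2-> res1 -d1-> res0 -d0-> M -> 0  of the free
   resolution obtained by taking at each step all the elements of the kernel
   as generators; fglift is the linear extension to the free module of a
   map defined on its basis. *)
Definition res0 : lmodType A := {freeg M / A}.
Definition res_d0 : res0 -> M := fglift id.
Definition res1 : lmodType A := {freeg {x : res0 | res_d0 x == 0} / A}.
Definition res_d1 : res1 -> res0 := fglift val.
Definition res2 : lmodType A := {freeg {x : res1 | res_d1 x == 0} / A}.
Definition res_d2 : res2 -> res1 := fglift val.

End Resolution.

Section Tensor.
Variable A : comNzRingType.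
Implicit Types U V : lmodType A.

Definition bilinear_rel U V : set {freeg (U * V)%type / A} :=
  let e (u : U) (v : V) : {freeg (U * V)%type / A} := free_gen A (u, v) in
  [set r | [\/ exists u u' v, r = e (u + u') v - e u v - e u' v,
               exists u v v', r = e u (v + v') - e u v - e u v',
               exists a u v, r = e (a *: u) v - a *: e u v |
               exists a u v, r = e u (a *: v) - a *: e u v]].

Definition tensor U V : lmodType A := quotmod (bilinear_rel (U := U) (V := V)).

(* f (x) id_V, for f linear *)
Definition tensor_map U U' V (f : U -> U') (x : tensor U V) : tensor U' V :=
  \pi_(quotmod (bilinear_rel (U := U') (V := V)))
    (fglift (fun p : U * V => free_gen A (f p.1, p.2)) (repr x)).

Definition Tor1 U V : lmodType A :=
  subquot [set x : tensor (res1 U) V | tensor_map (@res_d1 A U) x = 0]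
          (range (@tensor_map _ _ V (@res_d2 A U))).

End Tensor.

Section Ext.
Variables (A : comNzRingType) (M N : lmodType A).

Definition ext_cocycle : set (res1 M -> N) :=
  [set f | linear f /\ f \o @res_d2 A M = 0].

Definition ext_coboundary : set (res1 M -> N) :=
  [set g \o @res_d1 A M | g in [set g : res0 M -> N | linear g]].

Definition Ext1 : lmodType A := subquot ext_cocycle ext_coboundary.

Record extension := Extension {
  ext_mod : lmodType A;
  ext_in : {linear N -> ext_mod};
  ext_out : {linear ext_mod -> M};
  ext_in_inj : injective ext_in;
  ext_exact : range ext_in = [set x | ext_out x = 0];
  ext_out_surj : range ext_out = setT }.

(* The standard bijection between equivalence classes of extensions and Ext^1:
   lift the identity of M to a map from the resolution to the extension; its
   component res1 -> N is a cocycle, whose class depends only on E. *)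
Definition represents (E : extension) (alpha : Ext1) : Prop :=
  exists (g : res0 M -> ext_mod E) (f : submod ext_cocycle),
    [/\ linear g, ext_out E \o g = @res_d0 A M,
        g \o @res_d1 A M = ext_in E \o val f & alpha = \pi f].

End Ext.

(** * T-split extensions *)

Section TSplit.
Variables (R : realType) (A : comNzRingType) (d : nat) (F : int -> set A).

(* When M is finitely generated, Tor_1 is finitely generated and annihilated by
   an m-primary ideal, so that the lengths below are finite. *)
Definition eT (M : lmodType A) : R :=
  lim ((fun n : nat => (d.-1)`!%:R / n%:R ^+ d.-1 *
        fine (module_length (Tor1 M (@quotmod A A^o (F n.+1%:Z))) R)) @ \oo).

Definition eT_ext (M N : lmodType A) (E : extension M N) : R :=
  eT M + eT N - eT (ext_mod E).

Definition T_split (M N : lmodType A) : set (Ext1 M N) :=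
  [set alpha | exists2 E : extension M N, represents E alpha & eT_ext E = 0].

End TSplit.

(* Main.v *)
From HB Require Import structures.
Require Import Defs.
From mathcomp Require Import all_boot all_order all_algebra.
From mathcomp Require Import generic_quotient ring_quotient.
From mathcomp.multinomials Require Import freeg.
From mathcomp Require Import all_classical all_reals all_analysis.
From mathcomp Require Import zify ring.

(* Tor_1(M, A/J) is (K ∩ JP)/JK for any short exact sequence 0 -> K -> P -> M -> 0
   with P projective. Let E be the extension of M by N given by a cocycle f. Then
   l(Tor_1(M, A/J)) + l(Tor_1(N, A/J)) - l(Tor_1(E, A/J)) is the sum of the lengths
   of the images of the connecting maps Tor_2(M, A/J) -> Tor_1(N, A/J) and
   Tor_1(M, A/J) -> N/JN. These maps are additive and A-linear in f, so that the sum
   is subadditive in f and does not grow when f is multiplied by a scalar. With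
   J = I_(n+1), the normalised limit of this sum is e^T of the extension, and its
   vanishing is therefore stable under the module operations of Ext^1.

   The limits exist because n |-> l((L ∩ F_n Q)/F_n L) is eventually a polynomial of
   degree < d when L is contained in a finite free module Q. Polynomiality is the
   Hilbert-Serre theorem. For the degree, Artin-Rees bounds this function by
   l(I^k L/I^(k+c) L) for some constant c and k = n - c, and l(L/I^k L) = O(k^d) since
   I contains d elements generating an ideal whose radical is m. *)

(** The defect is only subadditive in f: the image of a sum of maps lies in the sum of the images,
    and its kernel contains the intersection of the kernels. This suffices because each defect is a
    natural number, so that the normalised defect of a sum or multiple is squeezed between 0 and a
    sequence tending to 0. All comparisons are made at a fixed n, and e^T enters only as a limit.

    Two obstacles shape the rest. The Hilbert-Serre theorem bounds the degree by the number of
    generators of I, which may exceed d. Artin-Rees costs only a constant shift, so what remains to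
    be bounded is a difference l(L/I^(k+c) L) - l(L/I^k L), and taking this difference lowers the
    degree of growth from d to d - 1, which is the exponent in the definition of e^T. The other
    obstacle is that the resolution defining Tor_1 is free on all elements of a module and in
    general not finitely generated. Schanuel's comparison of projective covers moves the finiteness
    arguments to a finite free cover, and also lets Tor_1 of E be computed from the direct sum of
    the covers of N and M. *)

Set Implicit Arguments.
Unset Strict Implicit.
Unset Printing Implicit Defensive.

Import Order.TTheory GRing.Theory Num.Theory.
Import numFieldNormedType.Exports.

Local Open Scope classical_set_scope.
Local Open Scope ring_scope.
Local Open Scope quotient_scope.

(** * Submodules and their length *)

Section Submodules.
Variables (A : comNzRingType) (V : lmodType A).
Implicit Types S T Z B W : set V.

Lemma submod0 S : is_submod S -> S 0.
Proof. by case. Qed.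

Lemma submodD S x y : is_submod S -> S x -> S y -> S (x + y).
Proof. by case=> _ + _; apply. Qed.

Lemma submodZ S a x : is_submod S -> S x -> S (a *: x).
Proof. by case=> _ _; apply. Qed.

Lemma submodN S x : is_submod S -> S x -> S (- x).
Proof. by move=> hS Sx; rewrite -scaleN1r; exact: submodZ. Qed.

Lemma submodB S x y : is_submod S -> S x -> S y -> S (x - y).
Proof. by move=> hS Sx Sy; apply: submodD => //; exact: submodN. Qed.

Lemma submodDr S x y : is_submod S -> S y -> S (x + y) -> S x.
Proof. by move=> hS Sy Sxy; rewrite -(addrK y x); exact: submodB. Qed.

Lemma submodBr S x y : is_submod S -> S y -> S (x - y) -> S x.
Proof. by move=> hS Sy; apply: submodDr => //; exact: submodN. Qed.

Lemma submodT : is_submod [set: V].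
Proof. by split. Qed.

Lemma submod_zero : is_submod [set (0 : V)].
Proof. by split=> // [x y -> ->|a x ->]; rewrite ?addr0 ?scaler0. Qed.

Lemma submodI S T : is_submod S -> is_submod T -> is_submod (S `&` T).
Proof.
move=> hS hT; split.
- by split; exact: submod0.
- by move=> x y [Sx Tx] [Sy Ty]; split; exact: submodD.
- by move=> a x [Sx Tx]; split; exact: submodZ.
Qed.

Definition sumset S T : set V := [set x | exists2 s, S s & T (x - s)].

Lemma submod_sum S T : is_submod S -> is_submod T -> is_submod (sumset S T).
Proof.
move=> hS hT; split.
- by exists 0; rewrite ?subr0; exact: submod0.
- move=> x y [s Ss Tx] [t St Ty]; exists (s + t); first exact: submodD.
  by rewrite opprD addrACA; exact: submodD.
- move=> a x [s Ss Tx]; exists (a *: s); first exact: submodZ.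
  by rewrite -scalerBr; exact: submodZ.
Qed.

Lemma sumsetl S T : T 0 -> S `<=` sumset S T.
Proof. by move=> T0 s Ss; exists s => //; rewrite subrr. Qed.

Lemma sumsetr S T : S 0 -> T `<=` sumset S T.
Proof. by move=> S0 t Tt; exists 0 => //; rewrite subr0. Qed.

Lemma sumset_min S T W : is_submod W -> S `<=` W -> T `<=` W -> sumset S T `<=` W.
Proof.
move=> hW SW TW x [s /SW Ws /TW Wx].
by rewrite -(subrK s x); exact: submodD.
Qed.

Lemma sumsetS S S' T T' : S `<=` S' -> T `<=` T' -> sumset S T `<=` sumset S' T'.
Proof. by move=> SS TT x [s /SS Ss /TT Tx]; exists s. Qed.

Lemma sub_lspan S : S `<=` lspan S.
Proof. by move=> x Sx W [_]; exact. Qed.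

Lemma lspan_min S W : is_submod W -> S `<=` W -> lspan S `<=` W.
Proof. by move=> hW SW x; apply; split. Qed.

Lemma lspan_id S : is_submod S -> lspan S = S.
Proof.
by move=> hS; apply/seteqP; split; [exact: lspan_min|exact: sub_lspan].
Qed.

Lemma lspanS S T : S `<=` T -> lspan S `<=` lspan T.
Proof.
move=> ST; apply: lspan_min; first exact: lspan_is_submod.
by move=> x /ST; exact: sub_lspan.
Qed.

Lemma lspan_nil : lspan [set` [::]] = [set (0 : V)].
Proof.
apply/seteqP; split; first by apply: lspan_min => //; exact: submod_zero.
by move=> _ ->; case: (lspan_is_submod [set` [::] : seq V]).
Qed.

Lemma lspan_cons v (s : seq V) :
  lspan [set` v :: s] = [set x | exists a, lspan [set` s] (x - a *: v)].
Proof.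
have hs := lspan_is_submod [set` s]; have hvs := lspan_is_submod [set` v :: s].
apply/seteqP; split.
  apply: lspan_min; first split.
  - by exists 0; rewrite scale0r subr0; exact: submod0.
  - move=> x y [a sx] [b sy]; exists (a + b).
    by rewrite scalerDl opprD addrACA; exact: (submodD hs).
  - move=> c x [a sx]; exists (c * a).
    by rewrite -scalerA -scalerBr; exact: (submodZ _ hs).
  move=> x /=; rewrite inE => /orP[/eqP ->|xs].
    by exists 1; rewrite scale1r subrr; exact: submod0.
  by exists 0; rewrite scale0r subr0; exact: sub_lspan.
move=> x [a sx]; rewrite -(subrK (a *: v) x); apply: (submodD hvs).
  apply: lspanS sx => y /= ys; by rewrite inE ys orbT.
by apply: (submodZ _ hvs); apply: sub_lspan; rewrite /= mem_head.
Qed.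

Lemma lspan_cat (s t : seq V) :
  lspan [set` s ++ t] = sumset (lspan [set` s]) (lspan [set` t]).
Proof.
have hs := lspan_is_submod [set` s]; have ht := lspan_is_submod [set` t].
apply/seteqP; split.
  apply: lspan_min; first exact: submod_sum.
  move=> x /=; rewrite mem_cat => /orP[xs|xt].
    by apply: sumsetl; [exact: submod0|exact: sub_lspan].
  by apply: sumsetr; [exact: submod0|exact: sub_lspan].
apply: sumset_min; first exact: lspan_is_submod.
  by apply: lspanS => x /= xs; rewrite mem_cat xs.
by apply: lspanS => x /= xs; rewrite mem_cat xs orbT.
Qed.

End Submodules.

Section LinearMaps.
Variables (A : comNzRingType) (V W : lmodType A) (f : V -> W).
Hypothesis lf : linear f.

Lemma linD : {morph f : x y / x + y}.
Proof. by move=> x y; have := lf 1 x y; rewrite !scale1r. Qed.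

Lemma lin0 : f 0 = 0.
Proof. by apply: (addrI (f 0)); rewrite -linD !addr0. Qed.

Lemma linZ a x : f (a *: x) = a *: f x.
Proof. by have := lf a x 0; rewrite lin0 !addr0. Qed.

Lemma linN : {morph f : x / - x}.
Proof. by move=> x; rewrite -scaleN1r linZ scaleN1r. Qed.

Lemma linB : {morph f : x y / x - y}.
Proof. by move=> x y; rewrite linD linN. Qed.

Lemma submod_preimage (B : set W) : is_submod B -> is_submod (f @^-1` B).
Proof.
move=> hB; split.
- by rewrite /preimage /= lin0; exact: submod0.
- by move=> x y Bx By; rewrite /preimage /= linD; exact: submodD.
- by move=> a x Bx; rewrite /preimage /= linZ; exact: submodZ.
Qed.

Lemma submod_image (Z : set V) : is_submod Z -> is_submod (f @` Z).
Proof.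
move=> hZ; split.
- by exists 0; [exact: submod0|exact: lin0].
- move=> _ _ [x Zx <-] [y Zy <-]; exists (x + y); first exact: submodD.
  exact: linD.
- move=> a _ [x Zx <-]; exists (a *: x); first exact: submodZ.
  exact: linZ.
Qed.

Lemma image_lspan (S : set V) : f @` lspan S = lspan (f @` S).
Proof.
apply/seteqP; split.
  move=> _ [x Sx <-]; move: x Sx.
  change (lspan S `<=` f @^-1` lspan (f @` S)).
  apply: lspan_min; first exact/submod_preimage/lspan_is_submod.
  by move=> x Sx; apply: sub_lspan; exists x.
apply: lspan_min; first exact/submod_image/lspan_is_submod.
by move=> _ [x Sx <-]; exists x => //; exact: sub_lspan.
Qed.

End LinearMaps.

Section Length.
Variables (A : comNzRingType) (V : lmodType A).
Implicit Types Z B W : set V.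

(** The chain has n strict steps and ends at Z, but its bottom is any submodule containing B, and B
    itself is an arbitrary subset. The greatest n is still the length of Z/B when B is a submodule,
    and chains can be moved along maps without adjusting their lower end. *)
Fixpoint mchain B n Z : Prop :=
  [/\ is_submod Z, B `<=` Z &
      if n is k.+1 then exists2 Z', mchain B k Z' & Z' `<` Z else True].

Lemma mchain_submod B n Z : mchain B n Z -> is_submod Z.
Proof. by case: n => [|n] []. Qed.

Lemma mchain_sub B n Z : mchain B n Z -> B `<=` Z.
Proof. by case: n => [|n] []. Qed.

Lemma mchain0 B Z : is_submod Z -> B `<=` Z -> mchain B 0 Z.
Proof. by []. Qed.

Lemma mchainS B n Z Z' : mchain B n Z -> Z `<` Z' -> is_submod Z' ->
  mchain B n.+1 Z'.
Proof.
move=> c ZZ hZ'; split=> //; last by exists Z.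
by apply: subset_trans (mchain_sub c) _; case: ZZ.
Qed.

Lemma mchain_mono B n Z Z' : mchain B n Z -> Z `<=` Z' -> is_submod Z' ->
  mchain B n Z'.
Proof.
case: n => [|n] [hZ BZ]; first by move=> _ ZZ hZ'; split=> //; exact: subset_trans ZZ.
move=> [Z0 c [ZZ0 nZZ0]] ZZ' hZ'; apply: mchainS c _ hZ'.
split; first exact: subset_trans ZZ'.
by move=> Z'Z0; apply: nZZ0; exact: subset_trans Z'Z0.
Qed.

Lemma mchain_cat B W Z a b : mchain B b W -> mchain W a Z -> mchain B (a + b) Z.
Proof.
move=> cb; elim: a Z => [|a IHa] Z [hZ WZ]; first by move=> _; exact: mchain_mono cb _ _.
by move=> [Z' /IHa c ZZ]; exact: mchainS c ZZ hZ.
Qed.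

Lemma modular_law W Z Z' : is_submod Z -> is_submod Z' -> is_submod W ->
  Z `<=` Z' -> sumset Z' W `<=` sumset Z W -> Z' `&` W `<=` Z `&` W -> Z' `<=` Z.
Proof.
move=> hZ hZ' hW ZZ' sZ' iZ' x Z'x.
have [|z Zz Wxz] := sZ' x; first by apply: sumsetl => //; exact: submod0.
have /iZ'[Zxz _] : (Z' `&` W) (x - z) by split=> //; apply: submodB => //; exact: ZZ'.
exact: submodBr Zz Zxz.
Qed.

(** By [modular_law] a strict step cannot collapse both in the sum with W and in the intersection
    with W, so each step is counted in at least one of the two chains. This is the upper bound in
    the additivity of length. *)
Lemma mchain_split B W n Z : is_submod W -> B `<=` W -> mchain B n Z ->
  exists a b, [/\ (n <= a + b)%N, mchain W a (sumset Z W) &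
                  mchain B b (Z `&` W)].
Proof.
move=> hW BW; elim: n Z => [|n IHn] Z [hZ BZ].
  move=> _; exists 0%N, 0%N; split=> //; apply: mchain0.
  - exact: submod_sum.
  - by apply: sumsetr; exact: submod0.
  - exact: submodI.
  - by move=> x Bx; split; [exact: BZ|exact: BW].
move=> [Z' c [ZZ' nZZ']]; have hZ' := mchain_submod c.
have [a [b [nab ca cb]]] := IHn _ c.
have sZ : sumset Z' W `<=` sumset Z W by apply: sumsetS.
have iZ : Z' `&` W `<=` Z `&` W by move=> x [/ZZ'].
have [sZZ'|nsZZ'] := pselect (sumset Z W `<=` sumset Z' W).
  exists a, b.+1; rewrite addnS ltnS; split=> //.
    by apply: mchain_mono ca sZ _; exact: submod_sum.
  apply: mchainS cb _ (submodI hZ hW); split=> // iZZ'.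
  by apply: nZZ'; exact: modular_law iZZ'.
exists a.+1, b; rewrite addSn ltnS; split=> //.
  by apply: mchainS ca _ (submod_sum hZ hW); split.
by apply: mchain_mono cb iZ _; exact: submodI.
Qed.

Definition flen Z B : Prop := exists N, forall n, mchain B n Z -> (n <= N)%N.

(* 0 if there is no bound on the length of chains. *)
Definition len Z B : nat :=
  xget 0%N [set n | mchain B n Z /\ forall k, mchain B k Z -> (k <= n)%N].

Lemma lenP Z B : is_submod Z -> B `<=` Z -> flen Z B ->
  mchain B (len Z B) Z /\ forall k, mchain B k Z -> (k <= len Z B)%N.
Proof.
move=> hZ BZ [N hN]; rewrite /len; case: xgetP => [n -> //|nP]; exfalso.
have ex : exists n, `[< mchain B n Z >] by exists 0%N; apply/asboolP; exact: mchain0.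
have ub n : `[< mchain B n Z >] -> (n <= N)%N by move/asboolP; exact: hN.
have := nP (ex_maxn ex ub); apply; case: ex_maxnP => i /asboolP ci mi.
by split=> // k ck; apply: mi; exact/asboolP.
Qed.

Lemma len_unique Z B n : mchain B n Z -> (forall k, mchain B k Z -> (k <= n)%N) ->
  len Z B = n.
Proof.
move=> c mx; have fl : flen Z B by exists n.
have [c' mx'] := lenP (mchain_submod c) (mchain_sub c) fl.
by apply/eqP; rewrite eqn_leq mx // mx'.
Qed.

Lemma flen_trans Z W B : is_submod W -> B `<=` W -> W `<=` Z -> is_submod Z ->
  flen Z W -> flen W B -> flen Z B.
Proof.
move=> hW BW WZ hZ [a ha] [b hb]; exists (a + b)%N => n c.
have [a' [b' [nab ca cb]]] := mchain_split hW BW c.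
apply: leq_trans nab _; apply: leq_add.
  apply: ha; exact: mchain_mono ca (sumset_min hZ (@subset_refl _ Z) WZ) hZ.
by apply: hb; exact: mchain_mono cb (@subIsetr _ Z W) hW.
Qed.

Lemma mchain_bot B B' n Z : B' `<=` B -> mchain B n Z -> mchain B' n Z.
Proof.
move=> BB; elim: n Z => [|n IHn] Z [hZ BZ]; first by split=> //; exact: subset_trans BZ.
by move=> [Z' /IHn c ZZ]; exact: mchainS c ZZ hZ.
Qed.

Lemma flen_sub Z B Z' B' : is_submod Z' -> flen Z' B' -> Z `<=` Z' -> B' `<=` B -> flen Z B.
Proof.
move=> hZ' [N hN] ZZ BB; exists N => n c; apply: hN; apply: mchain_bot BB _.
exact: mchain_mono c ZZ hZ'.
Qed.

Lemma lenD Z W B : is_submod Z -> is_submod W -> B `<=` W -> W `<=` Z ->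
  flen Z B -> len Z B = (len Z W + len W B)%N.
Proof.
move=> hZ hW BW WZ fl.
have [ca ma] := lenP hZ WZ (flen_sub hZ fl (@subset_refl _ Z) BW).
have [cb mb] := lenP hW BW (flen_sub hZ fl WZ (@subset_refl _ B)).
apply: len_unique; first exact: mchain_cat cb ca.
move=> k c; have [a [b [kab ca' cb']]] := mchain_split hW BW c.
apply: leq_trans kab _; apply: leq_add.
  by apply: ma; exact: mchain_mono ca' (sumset_min hZ (@subset_refl _ Z) WZ) hZ.
by apply: mb; exact: mchain_mono cb' (@subIsetr _ Z W) hW.
Qed.

Lemma flen_id Z : flen Z Z.
Proof.
by exists 0%N => -[//|n] [_ _ [Z' /mchain_sub ZZ' [_ /(_ ZZ')]]].
Qed.

Lemma len_id Z : len Z Z = 0%N.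
Proof.
rewrite /len; case: xgetP => // n _; case: n => [//|n] [[_ _ [Z' /mchain_sub ZZ' [_ nZZ']]] _].
by case: nZZ'.
Qed.

Lemma len_le Z B Z' B' : is_submod Z -> is_submod B -> is_submod Z' ->
  B' `<=` B -> B `<=` Z -> Z `<=` Z' -> flen Z' B' -> (len Z B <= len Z' B')%N.
Proof.
move=> hZ hB hZ' BB BZ ZZ fl.
have BZ' : B' `<=` Z by apply: subset_trans BZ.
have flZ := flen_sub hZ' fl ZZ (@subset_refl _ B').
rewrite (lenD hZ' hZ BZ' ZZ fl); apply: leq_trans (leq_addl _ _).
by rewrite (lenD hZ hB BB BZ flZ) leq_addr.
Qed.

End Length.

Section LengthMap.
Variables (A : comNzRingType) (V W : lmodType A) (f : V -> W).
Hypothesis lf : linear f.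
Variables (Z : set V) (B : set W).
Hypotheses (hZ : is_submod Z) (hB : is_submod B).

(** The isomorphism theorem for chains: preimages and images under f preserve strict inclusions
    between Z ∩ f^-1(B) and Z on one side, B and f(Z) + B on the other. Since single chains are
    compared, both finiteness and the value of the length follow. *)
Lemma mchain_map n :
  mchain B n (sumset (f @` Z) B) <-> mchain (Z `&` f @^-1` B) n Z.
Proof.
have hf S : is_submod S -> is_submod (sumset (f @` S) B).
  by move=> hS; apply: submod_sum => //; exact: submod_image.
have Bs S : is_submod S -> B `<=` sumset (f @` S) B.
  by move=> hS; apply: sumsetr; exact: (submod0 (submod_image lf hS)).
have hg T : is_submod T -> is_submod (Z `&` f @^-1` T).
  by move=> hT; apply: submodI => //; exact: submod_preimage.
split.
  have ind T : mchain B n T -> T `<=` sumset (f @` Z) B ->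
      mchain (Z `&` f @^-1` B) n (Z `&` f @^-1` T).
    elim: n T => [|n IHn] T [hT BT].
      move=> _ _; apply: mchain0; first exact: hg.
      by move=> x [Zx Bx]; split=> //; exact: BT.
    move=> [T' c [TT' nTT']] TZ; have hT' := mchain_submod c.
    apply: mchainS (IHn T' c (subset_trans TT' TZ)) _ (hg _ hT).
    split; first by move=> x [Zx T'x]; split=> //; exact: TT'.
    move=> gTT'; apply: nTT' => t Tt; have [_ [z Zz <-] Btz] := TZ t Tt.
    have T'tz := mchain_sub c Btz.
    have [|_ T'z] := gTT' z; last by rewrite -(subrK (f z) t); exact: submodD.
    split=> //; rewrite /preimage /= -[f z](subKr t).
    by apply: submodB => //; exact: BT.
  move=> /ind/(_ (@subset_refl _ _)) c.
  by apply: mchain_mono c _ hZ => x [].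
have ind S : mchain (Z `&` f @^-1` B) n S -> S `<=` Z ->
    mchain B n (sumset (f @` S) B).
  elim: n S => [|n IHn] S [hS BS].
    by move=> _ _; apply: mchain0; [exact: hf|exact: Bs].
  move=> [S' c [SS' nSS']] SZ; have hS' := mchain_submod c.
  apply: mchainS (IHn S' c (subset_trans SS' SZ)) _ (hf _ hS).
  split; first by apply: sumsetS => //; exact: image_subset.
  move=> fSS'; apply: nSS' => s Ss.
  have [|_ [s' S's' <-] Bss'] := fSS' (f s).
    by apply: sumsetl; [exact: (submod0 hB)|exists s].
  apply: (submodBr hS' S's'); apply: (mchain_sub c); split.
    by apply: submodB => //; apply: SZ => //; exact: SS'.
  by rewrite /preimage /= linB.
by move=> c; apply: ind c (@subset_refl _ _).
Qed.

Lemma len_map : len (sumset (f @` Z) B) B = len Z (Z `&` f @^-1` B).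
Proof.
rewrite /len; congr xget; apply/seteqP; split=> n [c m]; split.
- exact/mchain_map.
- by move=> k /mchain_map; exact: m.
- exact/mchain_map.
- by move=> k /mchain_map; exact: m.
Qed.

Lemma flen_map : flen (sumset (f @` Z) B) B <-> flen Z (Z `&` f @^-1` B).
Proof. by split=> -[N hN]; exists N => n /mchain_map; exact: hN. Qed.

End LengthMap.

(** * Noetherian rings and modules of finite length *)

Section Smul.
Variables (A : comNzRingType).
Implicit Types (I J : set A).

Lemma smul_submod (V : lmodType A) I (X : set V) : is_submod (smul I X).
Proof. exact: lspan_is_submod. Qed.

Lemma mem_smul (V : lmodType A) I (X : set V) a x : I a -> X x -> smul I X (a *: x).
Proof. by move=> Ia Xx; apply: sub_lspan; exists a => //; exists x. Qed.

Lemma smul_min (V : lmodType A) I (X W : set V) : is_submod W ->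
  (forall a x, I a -> X x -> W (a *: x)) -> smul I X `<=` W.
Proof. by move=> hW IW; apply: lspan_min => // _ [a Ia [x Xx <-]]; exact: IW. Qed.

Lemma smulS (V : lmodType A) I J (X Y : set V) :
  I `<=` J -> X `<=` Y -> smul I X `<=` smul J Y.
Proof.
move=> IJ XY; apply: (smul_min (smul_submod J Y)) => a x Ia Xx.
by apply: mem_smul; [exact: IJ|exact: XY].
Qed.

Lemma smul_sub (V : lmodType A) I (X : set V) : is_submod X -> smul I X `<=` X.
Proof. by move=> hX; apply: smul_min => // a x _; exact: submodZ. Qed.

Lemma image_smul (V W : lmodType A) (f : V -> W) I (X : set V) :
  linear f -> f @` smul I X = smul I (f @` X).
Proof.
move=> lf; rewrite /smul image_lspan//; congr lspan; apply/seteqP; split.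
  move=> _ [_ [a Ia [x Xx <-]] <-]; exists a => //; exists (f x); first by exists x.
  by rewrite linZ.
move=> _ [a Ia [_ [x Xx <-] <-]]; exists (a *: x); last exact: linZ.
by exists a => //; exists x.
Qed.

Lemma scale_linear (V : lmodType A) (a : A) : linear (fun x : V => a *: x).
Proof. by move=> b x y; rewrite scalerDr !scalerA mulrC. Qed.

Lemma scalel_linear (V : lmodType A) (x : V) : linear (fun a : A^o => a *: x).
Proof. by move=> b a c; rewrite scalerDl -scalerA. Qed.

Lemma smulA (V : lmodType A) I J (X : set V) :
  smul (ideal_mul I J) X = smul I (smul J X).
Proof.
apply/seteqP; split.
  apply: (smul_min (smul_submod _ _)) => a x + Xx; move: a.
  change (smul I (J : set A^o) `<=` (fun a : A^o => a *: x) @^-1` smul I (smul J X)).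
  apply: smul_min.
    by apply: submod_preimage; [exact: scalel_linear|exact: smul_submod].
  move=> a b Ia Jb; rewrite /preimage /= -scalerA.
  by apply: mem_smul => //; exact: mem_smul.
apply: (smul_min (smul_submod _ _)) => a y Ia; move: y.
change (smul J X `<=` (fun y => a *: y) @^-1` smul (ideal_mul I J) X).
apply: smul_min.
  by apply: submod_preimage; [exact: scale_linear|exact: smul_submod].
move=> b x Jb Xx; rewrite /preimage /= scalerA.
by apply: mem_smul => //; exact: mem_smul.
Qed.

Lemma smul_lspan (V : lmodType A) (I : set A) (X : set V) : is_submod X ->
  smul (@lspan A A^o I) X = smul I X.
Proof.
move=> hX; apply/seteqP; split; last by apply: smulS => // a; exact: sub_lspan.
apply: (smul_min (smul_submod _ _)) => a x + Xx; move: a.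
change (@lspan A A^o I `<=` (fun a : A^o => a *: x) @^-1` smul I X).
apply: lspan_min; first by apply: submod_preimage; [exact: scalel_linear|exact: smul_submod].
by move=> a Ia; exact: mem_smul.
Qed.

End Smul.

Arguments scale_linear {A} V a.
Arguments scalel_linear {A V} x.

Section IdealOperations.
Variable A : comNzRingType.
Implicit Type J : set A.

Lemma idealM J a x : is_ideal J -> J x -> J (a * x).
Proof. by move=> hJ Jx; exact: (submodZ a hJ). Qed.

Lemma is_ideal_add_principal J a : is_ideal J -> is_ideal [set x | exists b, J (x - b * a)].
Proof.
move=> hJ; split.
- by exists 0; rewrite mul0r subr0; exact: (submod0 hJ).
- move=> x y [b Jx] [c Jy]; exists (b + c).
  by rewrite mulrDl opprD addrACA; exact: (submodD hJ).
- move=> e x [b Jx]; exists (e * b).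
  by rewrite -mulrA -[e *: x]/(e * x) -mulrBr; exact: (submodZ e hJ).
Qed.

End IdealOperations.

Section Noetherian.
Variable A : comNzRingType.
Hypothesis nA : noetherian A.

Lemma fingen_sub (V : lmodType A) (Z S : set V) :
  fingen Z -> is_submod S -> S `<=` Z -> fingen S.
Proof.
move=> [s ->] hS; elim: s S hS => [|v s IHs] S hS SZ.
  exists [::]; rewrite lspan_nil in SZ *; apply/seteqP; split=> // x ->; exact: submod0.
have hs := lspan_is_submod [set` s].
have [|t St] := IHs (S `&` lspan [set` s]) (submodI hS hs); first by move=> x [].
(* The ideal of coefficients of v in elements of S modulo the span of s. Lifts to S of its
   generators, together with generators of S ∩ span s, generate S. *)
pose c : set A^o := [set a | exists2 x, S x & lspan [set` s] (x - a *: v)].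
have hc : is_submod c.
  split.
  - by exists 0; [exact: submod0|rewrite scale0r subr0; exact: (submod0 hs)].
  - move=> a b [x Sx sx] [y Sy sy]; exists (x + y); first exact: submodD.
    by rewrite scalerDl opprD addrACA; exact: (submodD hs).
  - move=> a b [x Sx sx]; exists (a *: x); first exact: submodZ.
    by rewrite -scalerA -scalerBr; exact: (submodZ _ hs).
have [g cg] := nA hc.
have : exists2 u : seq V, (forall x, x \in u -> S x) &
    forall a, lspan [set` g] a -> exists2 x, lspan [set` u] x & lspan [set` s] (x - a *: v).
  have : forall a, a \in g -> c a by move=> a ag; rewrite cg; exact: sub_lspan.
  elim: (g) => [|a g0 IHg] gc.
    exists [::] => // a; rewrite lspan_nil => ->; exists 0.
      by rewrite lspan_nil.
    by rewrite scale0r subr0; exact: (submod0 hs).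
  have [|u uS ug] := IHg; first by move=> b bg; apply: gc; rewrite inE bg orbT.
  have [x Sx sx] : exists2 x, S x & lspan [set` s] (x - a *: v) by apply: (gc a); exact: mem_head.
  exists (x :: u) => [y|b]; first by rewrite inE => /orP[/eqP->//|]; exact: uS.
  rewrite (@lspan_cons A A^o) => -[e /ug[y uy sy]]; exists (y + e *: x).
    by rewrite lspan_cons; exists e; rewrite addrK.
  rewrite -(subrK (e *: a) b) scalerDl opprD addrACA -scalerA -scalerBr.
  by apply: (submodD hs) => //; exact: (submodZ _ hs).
move=> [u uS ug]; exists (u ++ t); rewrite lspan_cat.
have uS' : lspan [set` u] `<=` S by apply: lspan_min.
apply/seteqP; split; last first.
  by apply: sumset_min => //; rewrite -St => x [].
move=> x Sx; have := SZ _ Sx; rewrite lspan_cons => -[a xa].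
have /ug[y uy sy] : lspan [set` g] a by rewrite -cg; exists x.
exists y => //; rewrite -St; split; first by apply: submodB => //; exact: uS'.
have -> : x - y = (x - a *: v) - (y - a *: v) by rewrite opprB addrA subrK.
exact: (submodB hs).
Qed.

Section FiniteLength.
Variables (m : set A) (V : lmodType A).
Hypothesis m_max : maximal_ideal m.
Implicit Types Z B W : set V.

Lemma maximal_inv a : ~ m a -> exists b, m (1 - a * b).
Proof.
move=> nma; case: (m_max) => hm m1 mJ.
pose J : set A := [set x | exists b : A, m (x - b * a)].
have hJ : is_ideal J by exact: is_ideal_add_principal.
have [J1|nJ1] := pselect (J 1); first by have [b] := J1; rewrite mulrC; exists b.
have mJ' : m `<=` J by move=> x mx; exists 0; rewrite mul0r subr0.
by case: nma; rewrite -(mJ _ hJ nJ1 mJ'); exists 1; rewrite mul1r subrr; exact: (submod0 hm).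
Qed.

(** In a chain with two steps an element of the middle term outside the lower one is a v modulo B
    with a outside m. Such an a is invertible modulo m, and m v lies in B, so the middle term
    contains v and hence all of Z. *)
Lemma flen_cyclic Z B v : is_submod Z -> is_submod B ->
  Z `<=` [set x | exists a, B (x - a *: v)] -> (forall c, m c -> B (c *: v)) ->
  flen Z B.
Proof.
move=> hZ hB Zv mv; exists 1%N => -[//|[//|n]] [_ _ [Z' c' [Z'Z nZZ']]]; exfalso.
have c : mchain B n.+1 Z' := c'; clear c'.
have hZ' := mchain_submod c; have BZ' := mchain_sub c.
case: c => _ _ [Z'' c [_ nZ'Z'']]; apply: nZZ'; have BZ'' := mchain_sub c.
have [w Z'w nZ''w] : exists2 w, Z' w & ~ Z'' w.
  by apply: contrapT => nw; apply: nZ'Z'' => w Z'w; apply: contrapT => nZ''w; apply: nw; exists w.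
have [a Bwa] := Zv w (Z'Z _ Z'w).
have [b mb] : exists b, m (1 - a * b).
  apply: maximal_inv => ma; apply/nZ''w/BZ''.
  exact: (submodBr hB (mv _ ma)).
have Z'av : Z' (a *: v).
  by rewrite -[a *: v](subKr w); apply: (submodB hZ') => //; exact: BZ'.
have Z'v : Z' v.
  rewrite -[v]scale1r -(subrK (a * b) 1) scalerDl mulrC -[(b * a) *: v]scalerA.
  by apply: (submodD hZ'); [apply: BZ'; apply: mv; rewrite mulrC|exact: submodZ].
move=> x /Zv[e Bx]; rewrite -(subrK (e *: v) x).
by apply: (submodD hZ'); [exact: BZ'|exact: submodZ].
Qed.

Lemma flen_fingen Z B (s : seq V) : is_submod Z -> is_submod B -> B `<=` Z ->
  Z = sumset (lspan [set` s]) B -> (forall c z, m c -> Z z -> B (c *: z)) -> flen Z B.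
Proof.
move=> hZ hB BZ Zs; have sZ : lspan [set` s] `<=` Z.
  by rewrite Zs; apply: sumsetl; exact: submod0.
have {Zs} : Z `<=` sumset (lspan [set` s]) B by rewrite Zs.
elim: s B hB BZ sZ => [|v s IHs] B hB BZ sZ Zs mZ.
  suff -> : B = Z by exact: flen_id.
  by apply/seteqP; split=> // x /Zs[y]; rewrite lspan_nil => ->; rewrite subr0.
have Zv : Z v by apply: sZ; apply: sub_lspan; rewrite /= mem_head.
pose B' : set V := [set x | exists a, B (x - a *: v)].
have hB' : is_submod B'.
  split.
  - by exists 0; rewrite scale0r subr0; exact: submod0.
  - move=> x y [a Bx] [b By]; exists (a + b).
    by rewrite scalerDl opprD addrACA; exact: submodD.
  - move=> a x [b Bx]; exists (a * b).
    by rewrite -scalerA -scalerBr; exact: submodZ.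
have BB' : B `<=` B' by move=> x Bx; exists 0; rewrite scale0r subr0.
have B'Z : B' `<=` Z.
  by move=> x [a /BZ Zx]; apply: (submodBr hZ _ Zx); exact: submodZ.
apply: (@flen_trans _ _ Z B' B) => //.
  apply: IHs => //; last by move=> c z mc Zz; apply: BB'; exact: mZ.
  - apply: subset_trans sZ; apply: lspanS => x /= xs; by rewrite inE xs orbT.
  - move=> x /Zs[y]; rewrite lspan_cons => -[a sy] Bxy.
    by exists (y - a *: v) => //; exists a; rewrite opprB addrCA [X in B X]addrC addKr.
by apply: (@flen_cyclic B' B v) => // c mc; exact: mZ.
Qed.

Lemma flen_nilpotent_seq (ys : seq A) Z B : is_submod Z -> is_submod B -> B `<=` Z ->
  fingen Z -> (forall y, y \in ys -> exists e, forall z, Z z -> B (y ^+ e *: z)) ->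
  m `<=` @sumset A A^o (@lspan A A^o [set` ys]) [set c | forall z, Z z -> B (c *: z)] ->
  flen Z B.
Proof.
elim: ys Z B => [|y ys IHys] Z B hZ hB BZ fZ ysB mys.
  have [s Zs] := fZ; apply: (@flen_fingen Z B s) => // [|c z mc Zz].
    rewrite -Zs; apply/seteqP; split; first by apply: sumsetl; exact: submod0.
    exact: sumset_min.
  have [x] := mys _ mc; rewrite lspan_nil => -> h; have := h z Zz.
  by rewrite subr0.
have [e Be] := ysB y (mem_head _ _).
pose Zi i := sumset ((fun x => y ^+ i *: x) @` Z) B.
have hZi i : is_submod (Zi i).
  by apply: submod_sum => //; apply: submod_image => //; exact: scale_linear.
have BZi i : B `<=` Zi i.
  by apply: sumsetr; exists 0; [exact: submod0|rewrite scaler0].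
have ZiZ i : Zi i `<=` Z.
  by apply: sumset_min => // _ [z Zz <-]; exact: submodZ.
have mem_Zi i z : Z z -> Zi i (y ^+ i *: z).
  by move=> Zz; exists (y ^+ i *: z); [exists z|rewrite subrr; exact: submod0].
have ZiS i : Zi i.+1 `<=` Zi i.
  apply: sumset_min => // _ [z Zz <-]; rewrite exprSr -scalerA.
  by apply: mem_Zi; exact: submodZ.
have flZ i : flen Z (Zi i).
  elim: i => [|i IHi].
    suff -> : Zi 0%N = Z by exact: flen_id.
    by apply/seteqP; split=> // z Zz; rewrite -[z]scale1r -(expr0 y); exact: mem_Zi.
  apply: (@flen_trans _ _ Z (Zi i)) => //; apply: IHys => //.
  - exact: fingen_sub fZ _ (ZiZ i).
  - move=> y' y'ys; have [|k Bk] := ysB y'; first by rewrite inE y'ys orbT.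
    exists k => x [_ [z Zz <-] Bxz]; apply: BZi.
    rewrite -(subrK (y ^+ i *: z) x) scalerDr; apply: (submodD hB); first exact: submodZ.
    by rewrite scalerA mulrC -scalerA; apply: submodZ => //; exact: Bk.
  - move=> c /mys[l]; rewrite lspan_cons => -[a la] hcl.
    exists (l - a *: (y : A^o)) => // x Zix.
    suff : Zi i.+1 ((c - ((l : A) - a * y)) *: x) by [].
    have -> : (c - ((l : A) - a * y)) *: x = (c - (l : A)) *: x + a *: (y *: x).
      by rewrite opprB addrA addrAC scalerDl scalerA.
    apply: (submodD (hZi _)); first by apply: BZi; apply: hcl; exact: ZiZ Zix.
    apply: (submodZ _ (hZi _)); case: Zix => _ [z Zz <-] Bxz.
    rewrite -(subrK (y ^+ i *: z) x) scalerDr scalerA -exprS.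
    by apply: (submodD (hZi _)); [apply: BZi; exact: submodZ|exact: mem_Zi].
have ZeB : Zi e `<=` B by apply: sumset_min => // _ [z Zz <-]; exact: Be.
by apply: (flen_sub hZ (flZ e)) => //.
Qed.

Lemma flen_nilpotent Z B : is_submod Z -> is_submod B -> B `<=` Z -> fingen Z ->
  (forall x, m x -> exists e, forall z, Z z -> B (x ^+ e *: z)) -> flen Z B.
Proof.
move=> hZ hB BZ fZ mZ; have [hm _ _] := m_max; have [ys mys] := nA hm.
apply: (@flen_nilpotent_seq ys) => //.
  by move=> y yys; apply: mZ; rewrite mys; exact: sub_lspan.
rewrite -mys; apply: (@sumsetl A A^o) => z _; rewrite scale0r; exact: submod0.
Qed.

End FiniteLength.
End Noetherian.

(** * Parameters in a Cohen-Macaulay local ring *)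

Section PrimeIdeals.
Variable A : comNzRingType.
Implicit Types J p : set A.

Lemma maximal_avoiding J (S : set A) : is_ideal J -> J `&` S `<=` set0 ->
  exists p, [/\ is_ideal p, J `<=` p, p `&` S `<=` set0 &
    forall p', is_ideal p' -> p `<=` p' -> p' `&` S `<=` set0 -> p' = p].
Proof.
move=> hJ JS; pose P X := X = set0 \/ [/\ is_ideal X, J `<=` X & X `&` S `<=` set0].
have [F FP Ftot|p [Pp pmax]] := @Zorn_bigcup A P.
  have [F0|/existsNP[X /not_implyP[FX X0]]] := pselect (forall X, F X -> X = set0).
    left; apply/seteqP; split=> // x [X /F0 ->//].
  right; split.
  - have FI Y y : F Y -> Y y -> is_ideal Y.
      by move=> FY Yy; case: (FP Y FY) => [Y0|[]//]; rewrite Y0 in Yy.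
    split.
    + exists X => //; by case: (FP X FX) => [//|[hX _ _]]; exact: (submod0 hX).
    + move=> x y [Y FY Yx] [Z FZ Zy].
      have [YZ|ZY] := Ftot Y Z FY FZ.
        by exists Z => //; apply: (submodD (FI _ _ FZ Zy)) => //; exact: YZ.
      by exists Y => //; apply: (submodD (FI _ _ FY Yx)) => //; exact: ZY.
    + by move=> a x [Y FY Yx]; exists Y => //; exact: (submodZ a (FI _ _ FY Yx)).
  - move=> x Jx; exists X => //; by case: (FP X FX) => [//|[_ JX _]]; exact: JX.
  - by move=> x [[Y FY Yx] Sx]; case: (FP Y FY) => [Y0|[_ _ YS]]; [rewrite Y0 in Yx|apply: (YS x)].
have J0 : J 0 by exact: (submod0 hJ).
case: Pp => [p0|[hp Jp pS]].
  exfalso; apply: (pmax J); last by right; split=> //; exact: subset_refl.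
  by rewrite p0; split=> // /(_ _ J0).
exists p; split=> // p' hp' pp' p'S; apply/seteqP; split=> //.
apply: contrapT => np'p; apply: (pmax p') => //.
by right; split=> //; exact: subset_trans pp'.
Qed.

Lemma prime_avoiding J (S : set A) : is_ideal J -> J `&` S `<=` set0 -> S 1 ->
  (forall x y, S x -> S y -> S (x * y)) ->
  exists p, [/\ prime_ideal p, J `<=` p & p `&` S `<=` set0].
Proof.
move=> hJ JS S1 SM; have [p [hp Jp pS pmax]] := maximal_avoiding hJ JS.
exists p; split=> //; split=> // [p1|x y pxy]; first exact: (pS 1).
have ext z : ~ p z -> exists s b, S s /\ p (s - b * z).
  move=> npz; apply: contrapT => nex; apply: npz.
  rewrite -(pmax _ (is_ideal_add_principal z hp)).
  - by exists 1; rewrite mul1r subrr; exact: (submod0 hp).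
  - by move=> w pw; exists 0; rewrite mul0r subr0.
  - by move=> s [[b pb] Ss]; case: nex; exists s, b.
apply: contrapT => /not_orP[/ext[s [b [Ss psb]]] /ext[t [c [St ptc]]]].
apply: (pS (s * t)); split; last exact: SM.
have -> : s * t = t * (s - b * x) + (b * x * (t - c * y) + (b * c) * (x * y)).
  rewrite !mulrBr (mulrC s t) [b * x * (c * y)]mulrACA [b * x * t]mulrC.
  by rewrite (subrK (b * c * (x * y))) (subrK (t * (b * x))).
by apply: (submodD hp); [|apply: (submodD hp)]; exact: idealM.
Qed.

Lemma maximal_over J : is_ideal J -> ~ J 1 -> exists2 p, maximal_ideal p & J `<=` p.
Proof.
move=> hJ J1; have [|p [hp Jp p1 pmax]] := @maximal_avoiding J [set 1] hJ.
  by move=> y [Jy /= y1]; apply: J1; rewrite -y1.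
exists p => //; split=> // [p1'|p' hp' np'1 pp']; first by apply: (p1 1).
by apply: pmax => // y [p'y /= y1]; apply: np'1; rewrite -y1.
Qed.

(* The set of products s x^n with s outside p is multiplicative and misses J. *)
Lemma prime_below J p x : is_ideal J -> prime_ideal p -> J `<=` p -> p x ->
  (forall z, J (x * z) -> J z) -> exists q, [/\ prime_ideal q, J `<=` q & q `<` p].
Proof.
move=> hJ [hp p1 pM] Jp px xJ.
pose S : set A := [set y | exists s n, ~ p s /\ y = s * x ^+ n].
have Sp s : ~ p s -> S s by exists s, 0%N; rewrite expr0 mulr1.
have JS : J `&` S `<=` set0.
  move=> y [Jy [s [n [nps yE]]]]; move: Jy; rewrite {}yE; elim: n => [|n IHn].
    by rewrite expr0 mulr1 => /Jp.
  by rewrite exprS mulrCA => /xJ.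
have [||q [qprime Jq qS]] := prime_avoiding hJ JS; first exact: Sp.
  move=> _ _ [s [n [nps ->]]] [t [k [npt ->]]]; exists (s * t), (n + k)%N.
  by rewrite exprD mulrACA; split=> // /pM[].
exists q; split=> //; split=> [y qy|pq].
  by apply: contrapT => /Sp Sy; exact: (qS y).
by apply: (qS x); split; [exact: pq|exists 1, 1%N; rewrite mul1r].
Qed.

(** Each term is a nonzerodivisor modulo the ideal of the earlier ones, so [prime_below] leads from
    a prime containing it to a strictly smaller prime that still contains the earlier terms. Hence p
    has height at least i. *)
Lemma regular_prime_chain (s : seq A) i p : @regular_seq A A^o s -> (i <= size s)%N ->
  prime_ideal p -> @smul A A^o [set` take i s] setT `<=` p ->
  exists c : nat -> set A, [/\ c i = p, forall j, (j <= i)%N -> prime_ideal (c j) &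
    forall j, (j < i)%N -> c j `<` c j.+1].
Proof.
move=> [reg _]; elim: i p => [|i IHi] p si pp sp.
  by exists (fun=> p); split.
have sub : @smul A A^o [set` take i s] setT `<=` @smul A A^o [set` take i.+1 s] setT.
  apply: smulS => // x /= xs; rewrite (take_nth 0) // mem_rcons inE xs orbT //.
have psi : p s`_i.
  apply: sp; rewrite -[s`_i]mulr1; apply: (@mem_smul A A^o) => //=.
  by rewrite (take_nth 0) // mem_rcons mem_head.
have [q [qp sq qltp]] := @prime_below _ p s`_i (@smul_submod A A^o _ _) pp
  (subset_trans sub sp) psi (reg i si).
have [c [ci cp cc]] := IHi q (ltnW si) qp sq.
exists (fun j => if (j <= i)%N then c j else p); split.
- by rewrite ltnn.
- by move=> j _; case: ifP => // /cp.
move=> j; rewrite ltnS => ji; rewrite ji; case: ltnP => [|ij]; first exact: cc.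
have /eqP -> : j == i by rewrite eqn_leq ji ij.
by rewrite ci.
Qed.

(** If p were strictly below m, the chain of length d ending at p given by [regular_prime_chain]
    could be extended by m beyond the dimension. *)
Lemma prime_over_parameters (m : set A) d (s : seq A) p : noetherian_local m ->
  krull_dim A d -> size s = d -> @regular_seq A A^o s -> prime_ideal p ->
  [set` s] `<=` p -> p = m.
Proof.
move=> [_ locm] [_ dimd] sd reg pp sp; have [hp p1 _] := pp.
have mmax : maximal_ideal m by exact/locm.
have pm : p `<=` m by have [q /locm -> //] := maximal_over hp p1.
apply/seteqP; split=> //; apply: contrapT => nmp.
have mprime : prime_ideal m.
  have [hm m1 _] := mmax; split=> // x y mxy; apply: contrapT => /not_orP[nmx nmy].
  have [b mb] := maximal_inv mmax nmx; apply: nmy.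
  rewrite -[y]mul1r -(subrK (x * b) 1) mulrDl; apply: (submodD hm).
    by rewrite mulrC; exact: idealM.
  by rewrite (mulrC x) -mulrA; exact: idealM.
have sp' : @smul A A^o [set` take d s] setT `<=` p.
  rewrite -sd take_size; apply: smul_min => // a x /sp pa _.
  by rewrite -[a *: x]/(a * x) mulrC; exact: idealM.
have ds : (d <= size s)%N by rewrite sd.
have [c [cd cp cc]] := regular_prime_chain reg ds pp sp'.
suff /dimd : prime_chain A d.+1 by rewrite ltnn.
exists (fun j => if (j <= d)%N then c j else m); split.
  by move=> j _; case: ifP => // /cp.
move=> j; rewrite ltnS => jd; rewrite jd; case: ltnP => [|dj]; first exact: cc.
have /eqP -> : j == d by rewrite eqn_leq jd dj.
by rewrite cd.
Qed.

(** The terms of a regular sequence of length d are raised to powers lying in I. A prime over these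
    powers contains the terms themselves, hence is m by [prime_over_parameters]; so no prime over
    them avoids the powers of an element of m. *)
Lemma parameters (m I : set A) d : noetherian_local m -> krull_dim A d ->
  cohen_macaulay m -> primary_to m I ->
  exists qs : seq A, [/\ size qs = d, forall q, q \in qs -> I q &
    forall x, m x -> exists e, @lspan A A^o [set` qs] (x ^+ e)].
Proof.
move=> locm dimd [d' [dimd' [[s [sd' sm reg]] _]]] [[hI _ _] radI].
have dd' : d' = d.
  by case: dimd dimd' => [cd dmx] [cd' dmx']; apply/eqP; rewrite eqn_leq dmx ?dmx'.
have [e eI] : exists e : A -> nat, forall x, m x -> I (x ^+ e x).
  have : forall x, exists n, m x -> I (x ^+ n).
    move=> x; have [mx|nmx] := pselect (m x); last by exists 0%N.
    by move: mx; rewrite -radI => -[n Ixn]; exists n.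
  by move=> /choice[e he]; exists e.
exists [seq x ^+ e x | x <- s]; split; first by rewrite size_map sd'.
  by move=> _ /mapP[x xs ->]; apply: eI; exact: sm.
move=> x mx; apply: contrapT => nx.
set J := @lspan A A^o _ in nx.
have hJ : is_ideal J by exact: lspan_is_submod.
have [|||p [pp Jp pS]] := @prime_avoiding J [set y | exists n, y = x ^+ n] hJ.
- by move=> y [Jy [n yE]]; apply: nx; exists n; rewrite -yE.
- by exists 0%N.
- by move=> _ _ [n ->] [k ->]; exists (n + k)%N; rewrite exprD.
have sp : [set` s] `<=` p.
  move=> y /= ys; have : p (y ^+ e y).
    by apply: Jp; apply: sub_lspan; apply/mapP; exists y.
  have [hp p1 pM] := pp; elim: (e y) => [|n IHn]; first by rewrite expr0 => /p1.
  by rewrite exprS => /pM[].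
have pm := prime_over_parameters locm dimd (etrans sd' dd') reg pp sp.
by apply: (pS x); split; [rewrite pm|exists 1%N].
Qed.

End PrimeIdeals.

(** * The graded Hilbert basis theorem *)

Section HilbertBasis.
Variables (A : comNzRingType) (V : lmodType A).
Implicit Types (xs : seq A) (M U W : nat -> set V) (S T : set V).

Lemma smul_nil S : smul [set` [::]] S = [set (0 : V)].
Proof.
apply/seteqP; split; first by apply: smul_min => //; exact: submod_zero.
by move=> _ ->; exact: (submod0 (smul_submod _ _)).
Qed.

Lemma smul_cons x xs S : is_submod S ->
  smul [set` x :: xs] S `<=` sumset ((fun v => x *: v) @` S) (smul [set` xs] S).
Proof.
move=> hS; have hxS := submod_image (scale_linear V x) hS.
have hxsS := @smul_submod A V [set` xs] S.
apply: smul_min; first exact: submod_sum.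
move=> a v /=; rewrite inE => /orP[/eqP ->|axs] Sv.
  by apply: sumsetl; [exact: (submod0 hxsS)|exists v].
by apply: sumsetr; [exact: (submod0 hxS)|exact: mem_smul].
Qed.

Lemma acc (C : nat -> set V) : (forall S, is_submod S -> fingen S) ->
  (forall k, is_submod (C k)) -> (forall k, C k `<=` C k.+1) ->
  exists K, forall k, C k `<=` C K.
Proof.
move=> nV hC CS.
have Cle k l : (k <= l)%N -> C k `<=` C l.
  elim: l => [|l IHl]; first by rewrite leqn0 => /eqP->.
  rewrite leq_eqVlt => /orP[/eqP->//|]; rewrite ltnS => /IHl kl.
  exact: subset_trans (CS l).
have hU : is_submod (\bigcup_k C k).
  split.
  - by exists 0%N => //; exact: submod0.
  - move=> x y [k _ Cx] [l _ Cy]; exists (maxn k l) => //.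
    by apply: (submodD (hC _)); [exact: Cle (leq_maxl _ _) _ Cx|exact: Cle (leq_maxr _ _) _ Cy].
  - by move=> a x [k _ Cx]; exists k => //; exact: submodZ.
have [s Us] := nV _ hU.
have [K CK] : exists K, [set` s] `<=` C K.
  have : [set` s] `<=` \bigcup_k C k by rewrite Us; exact: sub_lspan.
  elim: (s) => [|v t IHt] vt; first by exists 0%N.
  have [|K tK] := IHt; first by move=> x /= xt; apply: vt; rewrite /= inE xt orbT.
  have [l _ Cv] : (\bigcup_k C k) v by apply: vt; rewrite /= mem_head.
  exists (maxn K l) => x /=; rewrite inE => /orP[/eqP ->|xt].
    exact: Cle (leq_maxr _ _) _ Cv.
  exact: Cle (leq_maxl _ _) _ (tK _ xt).
exists K => k x Cx; have : (\bigcup_k C k) x by exists k.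
by rewrite Us; exact: lspan_min.
Qed.

(* Graded modules over A[X_1, ..., X_s] are represented by pairs of families M, U of
   submodules of a fixed module V, standing for the direct sum of the M_n/U_n, where
   X_i acts from degree n to degree n + 1 as multiplication by x_i. *)
Definition graded xs M : Prop := (forall n, is_submod (M n)) /\
  forall x n v, x \in xs -> M n v -> M n.+1 (x *: v).

Definition stable xs M U : Prop :=
  exists n0, forall n, (n0 <= n)%N -> M n.+1 `<=` sumset (smul [set` xs] (M n)) (U n.+1).

(* Every graded submodule of the direct sum of the M_n/U_n is generated in bounded
   degrees. *)
Definition noethpair xs M U : Prop := forall W, graded xs W ->
  (forall n, U n `<=` W n) -> (forall n, W n `<=` M n) -> stable xs W U.

(** The twist M(-1), with value zero in degree 0, so that multiplication by x becomes a map of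
    degree 0. *)
Definition shift M n : set V := if n is k.+1 then M k else [set 0].

(* M_n modulo this is the degree n part of the cokernel of X. *)
Definition mulshift x M U n : set V := sumset ((fun v => x *: v) @` shift M n) (U n).

Lemma submod_shift M n : (forall k, is_submod (M k)) -> is_submod (shift M n).
Proof. by case: n => [|n] hM; [exact: submod_zero|exact: hM]. Qed.

Lemma shift_mul y xs M n v : graded xs M -> y \in xs -> shift M n v ->
  shift M n.+1 (y *: v).
Proof.
move=> [hM My] yxs; case: n => [|n] /=; last exact: My.
by move=> ->; rewrite scaler0; exact: submod0.
Qed.

Lemma graded_cons x xs M : graded (x :: xs) M -> graded xs M.
Proof. by move=> [hM Mx]; split=> // y n v yxs; apply: Mx; rewrite inE yxs orbT. Qed.

Lemma graded_pow x xs M n k v : graded xs M -> x \in xs -> M n v ->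
  M (n + k)%N (x ^+ k *: v).
Proof.
move=> [hM Mx] xxs Mv; elim: k => [|k IHk]; first by rewrite addn0 scale1r.
by rewrite addnS exprS -scalerA; exact: Mx.
Qed.

Lemma submod_mulshift x xs M U n : graded xs M -> graded xs U ->
  is_submod (mulshift x M U n).
Proof.
move=> [hM _] [hU _]; apply: submod_sum => //.
by apply: submod_image; [exact: scale_linear|exact: submod_shift].
Qed.

Lemma graded_mulshift x xs M U : graded xs M -> graded xs U -> graded xs (mulshift x M U).
Proof.
move=> gM gU; split=> [n|y n w yxs [_ [v Mv <-] Uv]]; first exact: submod_mulshift gM gU.
exists (x *: (y *: v)); first by exists (y *: v) => //; exact: shift_mul gM _ Mv.
rewrite scalerA mulrC -scalerA -scalerBr; by case: gU => _; apply.
Qed.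

Lemma mulshift_sub x xs M U n : graded (x :: xs) M -> (forall n, U n `<=` M n) ->
  mulshift x M U n `<=` M n.
Proof.
move=> [hM Mx] UM; apply: sumset_min => // _ [v Mv <-].
case: n Mv => [|n] /=; last by apply: Mx; rewrite mem_head.
by move=> ->; rewrite scaler0; exact: submod0.
Qed.

Lemma sub_mulshift x xs M U n : graded xs M -> U n `<=` mulshift x M U n.
Proof.
move=> [hM _]; apply: sumsetr; exists 0; last exact: scaler0.
exact: (submod0 (submod_shift n hM)).
Qed.

Section Step.
Variables (x : A) (xs : seq A) (M U W : nat -> set V).
Hypotheses (nV : forall S, is_submod S -> fingen S)
  (gM : graded (x :: xs) M) (gU : graded (x :: xs) U) (gW : graded (x :: xs) W)
  (UW : forall n, U n `<=` W n) (WM : forall n, W n `<=` M n)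
  (IH : noethpair xs M (mulshift x M U)).

(* The leading coefficients of order k along the filtration of M by the x^k M. *)
Definition leadc k n : set V := [set v | M n v /\
  sumset (W (n + k)) ((fun v => x ^+ k.+1 *: v) @` shift M n) (x ^+ k *: v)].

Let hM n : is_submod (M n). Proof. by case: gM. Qed.
Let hW n : is_submod (W n). Proof. by case: gW. Qed.
Let hU n : is_submod (U n). Proof. by case: gU. Qed.
Let xx : x \in x :: xs. Proof. exact: mem_head. Qed.
Let gM' := graded_cons gM.

Lemma submod_lead_rel k n i :
  is_submod (sumset (W i) ((fun v => x ^+ k *: v) @` shift M n)).
Proof.
apply: submod_sum => //; apply: submod_image; first exact: scale_linear.
exact: submod_shift.
Qed.

Lemma graded_leadc k : graded xs (leadc k).
Proof.
split=> [n|y n v yxs [Mv [w Ww [u Mu uE]]]].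
  apply: (submodI (hM n)).
  exact: (submod_preimage (scale_linear V (x ^+ k)) (submod_lead_rel k.+1 n (n + k))).
split; first by case: gM' => _; exact.
exists (y *: w); first by rewrite addSn; case: (graded_cons gW) => _; exact.
exists (y *: u); first exact: shift_mul gM' yxs Mu.
by rewrite scalerA mulrC -scalerA uE scalerBr scalerA mulrC -scalerA.
Qed.

Lemma mulshift_leadc k n : mulshift x M U n `<=` leadc k n.
Proof.
move=> v xUv; split.
  exact: mulshift_sub gM (fun i => subset_trans (@UW i) (@WM i)) _ xUv.
case: xUv => _ [u Mu <-] Uv; exists (x ^+ k *: (v - x *: u)).
  by apply/UW; exact: graded_pow gU xx Uv.
by exists u => //; rewrite -scalerBr opprB addrCA subrr addr0 scalerA -exprSr.
Qed.

Lemma leadcS k n : leadc k n `<=` leadc k.+1 n.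
Proof.
move=> v [Mv [w Ww [u Mu uE]]]; split=> //; exists (x *: w).
  by rewrite addnS; case: gW => _; exact.
by exists u => //; rewrite exprS -scalerA uE scalerBr scalerA -exprS.
Qed.

(** In a single degree the increasing submodules [leadc k n] stabilise, but K has to be uniform in
    n. Their union over k is a graded submodule containing [mulshift x M U], hence generated in
    degrees at most some n1 by hypothesis. A K that serves the finitely many degrees up to n1 then
    serves all higher ones. *)
Lemma leadc_stationary : exists K, forall k n, leadc k n `<=` leadc K n.
Proof.
have hC k n : is_submod (leadc k n) by case: (graded_leadc k).
pose Cinf n := \bigcup_k leadc k n.
have CS k l n : (k <= l)%N -> leadc k n `<=` leadc l n.
  elim: l => [|l IHl]; first by rewrite leqn0 => /eqP->.
  rewrite leq_eqVlt => /orP[/eqP->//|]; rewrite ltnS => /IHl kl.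
  exact: subset_trans (@leadcS l n).
have stat n : exists K, forall k, leadc k n `<=` leadc K n.
  by apply: (acc nV) => // k; exact: leadcS.
have CinfE n : exists K, Cinf n = leadc K n.
  have [K CK] := stat n; exists K; apply/seteqP; split; last by move=> v Cv; exists K.
  by move=> v [k _ /CK].
have gCinf : graded xs Cinf.
  split=> [n|y n v yxs [k _ Cv]]; first by have [K ->] := CinfE n.
  by exists k => //; case: (graded_leadc k) => _; exact.
have [| |n1 Cst] := IH gCinf.
- by move=> n v xUv; exists 0%N => //; exact: mulshift_leadc.
- by move=> n v [k _ []].
have [K0 K0C] := choice stat.
pose K := (\max_(i < n1.+1) K0 i)%N; exists K.
have low n : (n <= n1)%N -> forall k, leadc k n `<=` leadc K n.
  move=> nn1 k; apply: subset_trans (K0C n k) _; apply: CS.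
  exact: (@leq_bigmax _ (fun i : 'I_n1.+1 => K0 i) (Ordinal (nn1 : (n < n1.+1)%N))).
move=> k n; have [/low//|n1n] := leqP n n1.
rewrite -(subnK (ltnW n1n)); elim: (n - n1)%N k => [|i IHi] k; first exact: low.
move=> v Cv; have /Cst[|t tC xUv] : Cinf (i.+1 + n1)%N v by exists k.
  by rewrite leq_addl.
rewrite -(subrK t v); apply: (submodD (hC _ _)); first exact: mulshift_leadc.
apply: smul_min tC => // y u /= yxs [l _ /IHi Cu].
by case: (graded_leadc K) => _; exact.
Qed.

Lemma stable_step : stable (x :: xs) W U.
Proof.
have [K CK] := leadc_stationary.
have stC k : stable xs (leadc k) (mulshift x M U).
  by apply: IH => [|n|n v []//]; [exact: graded_leadc|exact: mulshift_leadc].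
have [N0 N0C] := choice stC.
(* For an order k at most K, the bound n >= N + K keeps the degree n + 1 - k of the leading
   coefficient above N, where [leadc k] is generated from the preceding degree. *)
pose N := (\max_(k < K.+1) N0 k)%N; exists (N + K)%N => n nNK w Ww.
have hC k i : is_submod (leadc k i) by case: (graded_leadc k).
set G := sumset _ _.
have hG : is_submod G by apply: submod_sum => //; exact: smul_submod.
have GW : G `<=` W n.+1.
  apply: sumset_min => //; apply: smul_min => // a v /= axs.
  by case: gW => _; exact.
(* Modulo G, the element w is divisible by higher and higher powers of x. At k = n + 2 the cofactor
   lies in [shift M 0], which is zero, so that w belongs to G. *)
have claim k : (k <= n.+2)%N ->
    exists2 g, G g & exists2 v, shift M (n.+2 - k) v & w - g = x ^+ k *: v.
  elim: k => [_|k IHk kn].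
    exists 0; first exact: (submod0 hG).
    by exists w; [exact: WM|rewrite subr0 scale1r].
  have [g Gg] := IHk (ltnW kn); rewrite subSn // => -[v Mv gv].
  rewrite subSS; set j := (n.+1 - k)%N in Mv *.
  have jk : (j + k = n.+1)%N by rewrite subnK.
  have Cv : leadc k j v.
    split=> //; exists (x ^+ k *: v).
      by rewrite jk -gv; apply: (submodB (hW _)) => //; exact: GW.
    by exists 0; [exact: (submod0 (submod_shift _ hM))|rewrite scaler0 subrr].
  (* Up to order K, the leading coefficient v is a combination, with coefficients in xs, of leading
     coefficients of one degree less, modulo x M and U. Those are realised by elements of W_n, so
     subtracting an element of G raises the order. *)
  have [kK|Kk] := leqP k K.
    have Nj : (N < j)%N by rewrite -(ltn_add2r k) jk ltnS (leq_trans _ nNK) // leq_add2l.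
    case: j Mv jk Cv Nj => [//|j] Mv; rewrite addSn => -[jk] Cv Nj.
    have N0j : (N0 k <= j)%N.
      rewrite ltnS in Nj; apply: leq_trans Nj.
      exact: (@leq_bigmax _ (fun i : 'I_K.+1 => N0 i) (Ordinal (kK : (k < K.+1)%N))).
    have [t tC [_ [v1 Mv1 <-] Uv]] := N0C k j N0j v Cv.
    have [t1 Wt1 [t2 Mt2 t2E]] :
        sumset (smul [set` xs] (W n)) ((fun v => x ^+ k.+1 *: v) @` M j) (x ^+ k *: t).
      have hQ : is_submod (sumset (smul [set` xs] (W n)) ((fun v => x ^+ k.+1 *: v) @` M j)).
        apply: submod_sum; first exact: smul_submod.
        by apply: submod_image => //; exact: scale_linear.
      clear Uv; move: t tC.
      apply: (smul_min (submod_preimage (scale_linear V (x ^+ k)) hQ)).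
      move=> y u /= yxs [Mu [w' Ww' [u' Mu' u'E]]]; exists (y *: w').
        by apply: mem_smul => //; rewrite -jk.
      exists (y *: u'); first exact: (shift_mul gM' yxs Mu').
      by rewrite scalerA mulrC -scalerA u'E scalerBr scalerA mulrC -scalerA.
    exists (g + (t1 + x ^+ k *: (v - t - x *: v1))).
      apply: (submodD hG) => //; exists t1.
        by apply: smulS Wt1 => //= y yxs; rewrite /= inE yxs orbT.
      by rewrite addrAC subrr add0r -jk -addSn; exact: graded_pow gU xx Uv.
    exists (v1 + t2); first exact: (submodD (hM j)).
    rewrite [RHS]scalerDr t2E opprD addrA gv !scalerBr [in LHS]scalerA -exprSr.
    rewrite opprD !opprB addrC -!addrA addNr addr0.
    by rewrite addrC -addrA.
  (* Beyond order K, the coefficient v already occurs at order K, in some w' of W. The multiple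
     x^(k-K) w' has the same leading term as w - g, and it lies in x W_n because k > K. *)
  have [_ [w' Ww' [u Mu uE]]] := CK k j _ Cv.
  have kE : k = ((k - K.+1).+1 + K)%N by rewrite addSnnS subnK.
  exists (g + x ^+ (k - K.+1).+1 *: w').
    apply: (submodD hG) => //; apply: sumsetl; first exact: submod0.
    rewrite exprS -scalerA; apply: mem_smul; first by rewrite /= mem_head.
    have -> : n = (j + K + (k - K.+1))%N.
      by apply: succn_inj; rewrite -jk {1}kE addSn addnS addnA addnAC.
    exact: graded_pow gW xx Ww'.
  exists u => //; rewrite opprD addrA gv {1}kE exprD -scalerA -scalerBr -uE.
  by rewrite scalerA -exprD addnS -kE.
have [g Gg [v]] := claim _ (leqnn _); rewrite subnn => -> /eqP.
by rewrite scaler0 subr_eq0 => /eqP ->.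
Qed.

End Step.

(** Induction on the variables: the cokernel of x on M/U, encoded by the pair M, [mulshift x M U],
    is still generated in bounded degrees over the remaining variables, and [stable_step] passes
    from this cokernel back to M/U. *)
Theorem hilbert_basis xs M U : (forall S : set V, is_submod S -> fingen S) ->
  graded xs M -> graded xs U -> (forall n, U n `<=` M n) -> stable xs M U ->
  noethpair xs M U.
Proof.
move=> nV; elim: xs M U => [|x xs IHxs] M U gM gU UM [n0 Mst] W gW UW WM.
  by exists n0 => n n0n v /WM /(Mst _ n0n); rewrite !smul_nil.
apply: (stable_step nV gM gU gW UW WM); apply: IHxs.
- exact: graded_cons gM.
- by apply: graded_mulshift; [exact: graded_cons gM|exact: graded_cons gU].
- by move=> n; exact: mulshift_sub gM UM.
have [hM _] := gM; exists n0 => n n0n v /(Mst _ n0n)[t xt Utv].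
have [_ [u Mu <-] tu] := smul_cons (hM n) xt.
exists (t - x *: u) => //; exists (x *: u); first by exists u.
by rewrite opprB addrA addrAC addrK.
Qed.

End HilbertBasis.

(** * Eventually polynomial functions and the Hilbert-Serre theorem *)

Section PolynomialFunctions.
Variable R : realType.
Implicit Types (f g : nat -> R) (s t n : nat).

(* Eventually a polynomial of degree less than s. *)
Definition polyfun s f : Prop := exists n0 (c : nat -> R),
  forall n, (n0 <= n)%N -> f n = \sum_(j < s) c j * 'C(n, j)%:R.

Lemma polyfun_ext s f g : (exists n0, forall n, (n0 <= n)%N -> f n = g n) ->
  polyfun s f -> polyfun s g.
Proof.
move=> [n1 fg] [n0 [c fc]]; exists (maxn n0 n1), c => n.
by rewrite geq_max => /andP[n0n n1n]; rewrite -fg// fc.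
Qed.

Lemma polyfunB s f g : polyfun s f -> polyfun s g -> polyfun s (fun n => f n - g n).
Proof.
move=> [n0 [c fc]] [n1 [b gb]]; exists (maxn n0 n1), (fun j => c j - b j) => n.
rewrite geq_max => /andP[n0n n1n]; rewrite fc// gb// -sumrB.
by apply: eq_bigr => j _; rewrite mulrBl.
Qed.

Lemma polyfunD s f g : polyfun s f -> polyfun s g -> polyfun s (fun n => f n + g n).
Proof.
move=> [n0 [c fc]] [n1 [b gb]]; exists (maxn n0 n1), (fun j => c j + b j) => n.
rewrite geq_max => /andP[n0n n1n]; rewrite fc// gb// -big_split.
by apply: eq_bigr => j _; rewrite mulrDl.
Qed.

Lemma polyfunS s f : polyfun s f -> polyfun s.+1 f.
Proof.
move=> [n0 [c fc]]; exists n0, (fun j => if (j < s)%N then c j else 0) => n n0n.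
rewrite big_ord_recr /= ltnn mul0r addr0 fc//.
by apply: eq_bigr => j _; rewrite ltn_ord.
Qed.

(** In the basis of binomial coefficients, summation raises each lower index by one, by Pascal's
    rule; k is the constant of summation. *)
Lemma polyfun_sum s f : polyfun s (fun n => f n.+1 - f n) -> polyfun s.+1 f.
Proof.
move=> [n0 [c fc]].
pose g n := \sum_(j < s) c j * 'C(n, j.+1)%:R.
pose k := f n0 - g n0.
exists n0, (fun j => if j is i.+1 then c i else k) => n n0n.
rewrite big_ord_recl /= bin0 mulr1 -/(g n); apply/eqP; rewrite -subr_eq; apply/eqP.
rewrite -(subnK n0n); elim: (n - n0)%N => [//|i IHi]; rewrite addSn.
have -> : g (i + n0).+1 = g (i + n0)%N + (f (i + n0).+1 - f (i + n0)%N).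
  rewrite fc ?leq_addl// -big_split /=; apply: eq_bigr => j _.
  by rewrite binS natrD mulrDr.
by rewrite opprD opprB addrCA [f _ + (_ - _)]addrC subrK addrC.
Qed.

Lemma polyfun_diff s f : polyfun s.+1 f -> polyfun s (fun n => f n.+1 - f n).
Proof.
move=> [n0 [c fc]]; exists n0, (fun j => c j.+1) => n n0n.
rewrite !fc// 1?leqW// !big_ord_recl /= !bin0 opprD addrACA subrr add0r -sumrB.
by apply: eq_bigr => j _; rewrite /bump add1n binS natrD mulrDr addrAC subrr add0r.
Qed.

Lemma polyfun_shift s f : polyfun s f -> polyfun s (fun n => f n.+1).
Proof.
case: s => [|s] pf.
  have [n0 [c fc]] := pf; exists n0, c => n n0n; rewrite fc// ?leqW//.
  by rewrite !big_ord0.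
have := polyfunD pf (polyfunS (polyfun_diff pf)).
by apply: polyfun_ext; exists 0%N => n _; rewrite addrC subrK.
Qed.

Lemma cvg_to_eq f (l l' : R) : f n @[n --> \oo] --> l -> l = l' ->
  f n @[n --> \oo] --> l'.
Proof. by move=> + <-. Qed.

Lemma cvg_divn0 f (l : R) : f n @[n --> \oo] --> l -> f n / n%:R @[n --> \oo] --> (0 : R).
Proof.
move=> fl; rewrite -(mulr0 l); apply: cvgM => //.
by rewrite -cvg_shiftS; exact: cvg_harmonic.
Qed.

Lemma bin_cvg j : ('C(n, j)%:R : R) / n%:R ^+ j @[n --> \oo] --> ((j`!%:R)^-1 : R).
Proof.
elim: j => [|j IHj].
  under eq_cvg do rewrite bin0 expr0 divr1.
  by rewrite fact0 invr1; exact: cvg_cst.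
have -> : (j.+1`!%:R)^-1 = (j`!%:R)^-1 * (1 - 0) * j.+1%:R^-1 :> R.
  by rewrite subr0 mulr1 factS natrM invfM mulrC.
apply: (@cvg_trans _ (('C(n, j)%:R / n%:R ^+ j) * (1 - j%:R / n%:R) * j.+1%:R^-1
                        @[n --> \oo])); last first.
  apply: cvgMl; apply: cvgM => //; apply: cvgB; first exact: cvg_cst.
  by apply: (@cvg_divn0 _ j%:R); exact: cvg_cst.
apply: near_eq_cvg; exists j.+1 => // n /= jn.
have n0 : n%:R != 0 :> R by rewrite pnatr_eq0 -lt0n (leq_trans _ jn).
have := congr1 (fun k => k%:R : R) (mul_bin_left n j).
rewrite /= !natrM natrB 1?ltnW// => E.
have j0 : j.+1%:R != 0 :> R by rewrite pnatr_eq0.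
have -> : 'C(n, j.+1)%:R = (n%:R - j%:R) * 'C(n, j)%:R / j.+1%:R :> R.
  by rewrite -E mulrC mulKf.
have nj0 : n%:R ^+ j != 0 :> R by rewrite expf_neq0.
by rewrite exprS; field; rewrite nj0 n0 addrC natr1.
Qed.

Lemma bin_cvg0 j s : (j < s)%N ->
  ('C(n, j)%:R : R) / n%:R ^+ s @[n --> \oo] --> (0 : R).
Proof.
elim: s => [//|s IHs]; rewrite ltnS leq_eqVlt => js.
have E n : 'C(n, j)%:R / n%:R ^+ s.+1 = 'C(n, j)%:R / n%:R ^+ s / n%:R :> R.
  by rewrite exprSr invfM mulrA.
under eq_cvg do rewrite E.
case/orP: js => [/eqP <-|/IHs]; last exact: cvg_divn0.
exact: (@cvg_divn0 (fun n => 'C(n, j)%:R / n%:R ^+ j) _ (@bin_cvg j)).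
Qed.

Lemma sum_bin_cvg (c : nat -> R) s :
  (\sum_(j < s.+1) c j * 'C(n, j)%:R) / n%:R ^+ s @[n --> \oo] --> c s / s`!%:R.
Proof.
have low k : (k <= s)%N ->
    (\sum_(j < k) c j * 'C(n, j)%:R) / n%:R ^+ s @[n --> \oo] --> (0 : R).
  elim: k => [_|k IHk ks].
    under eq_cvg do rewrite big_ord0 mul0r.
    exact: cvg_cst.
  under eq_cvg do rewrite big_ord_recr /= mulrDl -mulrA.
  apply: (@cvg_to_eq _ (0 + c k * 0)); last by rewrite mulr0 addr0.
  apply: cvgD; first exact: IHk (ltnW ks).
  by apply: cvgMr; exact: bin_cvg0.
under eq_cvg do rewrite big_ord_recr /= mulrDl -mulrA.
apply: (@cvg_to_eq _ (0 + c s / s`!%:R)); last by rewrite add0r.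
apply: cvgD; first exact: low.
by apply: cvgMr; exact: bin_cvg.
Qed.

Lemma polyfun_cvg s f : polyfun s.+1 f -> cvgn (fun n => f n / n%:R ^+ s).
Proof.
move=> [n0 [c fc]]; apply/cvg_ex; exists (c s / s`!%:R).
apply: cvg_trans (@sum_bin_cvg c s); apply: near_eq_cvg.
by exists n0 => // n /= /fc ->.
Qed.

Definition bigOn t f : Prop := exists (C : R) n0, forall n, (n0 <= n)%N ->
  0 <= f n <= C * n%:R ^+ t.

Lemma polyfun_bigO s f : polyfun s.+1 f -> (forall n, 0 <= f n) -> bigOn s f.
Proof.
move=> /polyfun_cvg /cvg_ex[l fl] f0.
have [n0 _ hn0] : \forall n \near \oo, f n / n%:R ^+ s < l + 1.
  by apply: cvgr_lt fl _ _; rewrite ltrDl.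
exists (l + 1), n0.+1 => n n0n; rewrite f0 /=.
have n_gt0 : 0 < n%:R ^+ s :> R by rewrite exprn_gt0// ltr0n (leq_trans _ n0n).
by rewrite -ler_pdivrMr// ltW// hn0//= ltnW.
Qed.

(** As long as the top degree s exceeds t, the top coefficient divided by s! is the limit of f n /
    n^s, which the bound forces to be 0. The degree thus drops one step at a time. *)
Lemma bigOn_polyfun s t f : polyfun s f -> bigOn t f -> polyfun t.+1 f.
Proof.
move=> pf [C [n1 fC]]; elim: s pf => [|s IHs] pf.
  by elim: t.+1 => [//|k]; exact: polyfunS.
have [st|ts] := leqP s t.
  by rewrite -(subnK st) -addnS; elim: (t - s)%N => [//|k]; rewrite addSn; exact: polyfunS.
apply: IHs; have [n0 [c fc]] := pf; exists n0, c => n /fc ->.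
rewrite big_ord_recr /=; suff -> : c s = 0 by rewrite mul0r addr0.
have cs : f n / n%:R ^+ s @[n --> \oo] --> c s / s`!%:R.
  apply: cvg_trans (@sum_bin_cvg c s); apply: near_eq_cvg.
  by exists n0 => // k /= /fc ->.
have c0 : f n / n%:R ^+ s @[n --> \oo] --> (0 : R).
  apply: (@squeeze_cvgr _ _ _ _ (fun=> 0) (fun n => C / n%:R)); last 2 first.
  - exact: cvg_cst.
  - by apply: (@cvg_divn0 (fun=> C) C); exact: cvg_cst.
  exists n1.+1 => // k /= n1k; have /andP[f0 fCk] := fC k (ltnW n1k).
  have k0 : 0 < k%:R :> R by rewrite ltr0n (leq_trans _ n1k).
  apply/andP; split; first by rewrite divr_ge0// exprn_ge0// ltW.
  rewrite ler_pdivrMr ?exprn_gt0//.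
  apply: (le_trans fCk); rewrite -mulrA.
  have C0 : 0 <= C.
    by rewrite -(@pmulr_lge0 _ (k%:R ^+ t)) ?exprn_gt0// (le_trans f0 fCk).
  apply: ler_wpM2l => //; rewrite -(subnK ts) addnC addSn exprS mulKf ?gt_eqF//.
  rewrite exprD; apply: ler_peMr; first by rewrite exprn_ge0// ltW.
  by rewrite exprn_ege1// ler1n (leq_trans _ n1k).
have /eqP : c s / s`!%:R = 0 by exact: (cvg_unique (@Rhausdorff R) cs c0).
by rewrite mulf_eq0 invr_eq0 pnatr_eq0 eqn0Ngt fact_gt0 orbF => /eqP.
Qed.

End PolynomialFunctions.

Section HilbertSerre.
Variables (R : realType) (A : comNzRingType) (V : lmodType A).
Implicit Types (xs : seq A) (M U : nat -> set V).

(** Induction on the variables: x kills the kernel K/U and the cokernel M/Q of its own action on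
    M/U, so both are graded modules over the remaining variables. The hypothesis [noethpair] passes
    to both, being a condition on all graded submodules. *)
Theorem hilbert_serre xs M U : graded xs M -> graded xs U ->
  (forall n, U n `<=` M n) -> noethpair xs M U -> (forall n, flen (M n) (U n)) ->
  polyfun (size xs) (fun n => (len (M n) (U n))%:R : R).
Proof.
elim: xs M U => [|x xs IHxs] M U gM gU UM MU fl.
  have [||n0 Mst] := MU M gM; first exact: UM.
    by move=> n; exact: subset_refl.
  exists n0.+1, (fun=> 0) => -[//|n] n0n; rewrite big_ord0.
  suff -> : M n.+1 = U n.+1 by rewrite len_id.
  apply/seteqP; split; last exact: UM.
  by move=> v /(Mst _ n0n)[t]; rewrite smul_nil => -> ; rewrite subr0.
have [hM Mx] := gM; have [hU Ux] := gU.
have gM' := graded_cons gM; have gU' := graded_cons gU.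
have xx : x \in x :: xs by exact: mem_head.
pose K n : set V := M n `&` (fun v => x *: v) @^-1` U n.+1.
have hK n : is_submod (K n).
  by apply: submodI => //; apply: submod_preimage => //; exact: scale_linear.
have UK n : U n `<=` K n by move=> v Uv; split; [exact: UM|exact: Ux].
have KM n : K n `<=` M n by move=> v [].
have gK : graded xs K.
  split=> // y n v yxs [Mv Uxv]; split; first by case: gM' => _; exact.
  by rewrite /preimage /= scalerA mulrC -scalerA; case: gU' => _; exact.
pose Q := mulshift x M U.
have gQ : graded xs Q by exact: graded_mulshift.
have QM n : Q n `<=` M n by exact: mulshift_sub gM UM.
have UQ n : U n `<=` Q n by exact: sub_mulshift gM'.
have QE n : Q n.+1 = sumset ((fun v => x *: v) @` M n) (U n.+1) by [].
have hQ n : is_submod (Q n) by case: gQ.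
(* If x sends W_n into U'_(n+1), then W is also closed under x, and a bound on the degrees of
   generators over x :: xs is one over xs modulo U'. *)
have stab (W U' : nat -> set V) : graded xs W -> (forall n, U n `<=` W n) ->
    (forall n, W n `<=` M n) -> (forall n, is_submod (U' n)) -> (forall n, U n `<=` U' n) ->
    (forall n v, W n v -> U' n.+1 (x *: v)) -> (forall n, U' n `<=` W n) -> stable xs W U'.
  move=> [hW gW] UW WM hU' UU' xW U'W; have [|||n0 Wst] := MU W.
  - split=> // y n v; rewrite inE => /orP[/eqP -> /xW /U'W//|]; exact: gW.
  - exact: UW.
  - exact: WM.
  exists n0 => n n0n v /(Wst _ n0n)[t xt Uvt].
  have [_ [u Wu <-] tu] := smul_cons (hW n) xt.
  exists (t - x *: u) => //; rewrite opprB addrA addrAC.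
  by apply: (submodD (hU' _)); [exact: UU'|exact: xW].
have pQ : polyfun (size xs) (fun n => (len (M n) (Q n))%:R : R).
  apply: IHxs => // [W gW QW WM|n].
    apply: stab => // n; first exact: subset_trans (UQ n) (QW n).
    move=> v /WM Mv; rewrite QE; exists (x *: v); first by exists v.
    by rewrite subrr; exact: submod0.
  exact: flen_sub (hM n) (fl n) (@subset_refl _ _) (UQ n).
have pK : polyfun (size xs) (fun n => (len (K n) (U n))%:R : R).
  apply: IHxs => // [W gW UW WK|n].
    apply: stab => // [n|n|n v /WK[]//]; first exact: subset_trans (WK n) (KM n).
    exact: subset_refl.
  exact: flen_sub (hM n) (fl n) (KM n) (@subset_refl _ _).
(* The difference of the lengths in degrees n + 1 and n is the length of the
   cokernel in degree n + 1 minus the length of the kernel in degree n. *)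
apply: polyfun_sum; apply: polyfun_ext (polyfunB (polyfun_shift pQ) pK).
exists 0%N => n _.
rewrite (lenD (hM n.+1) (hQ n.+1) (@UQ n.+1) (@QM n.+1) (fl n.+1)).
rewrite (lenD (hM n) (hK n) (@UK n) (@KM n) (fl n)) QE.
rewrite (len_map (scale_linear V x) (hM n) (hU n.+1)) !natrD opprD.
by rewrite addrA addrK.
Qed.

Lemma graded_iter_smul xs (L : set V) : is_submod L ->
  graded xs (fun k => iter k (smul [set` xs]) L).
Proof.
move=> hL; split=> [[//|k]|x k v xxs Lv]; first exact: smul_submod.
exact: mem_smul.
Qed.

Lemma iter_smulS xs (L : set V) k : is_submod L ->
  iter k.+1 (smul [set` xs]) L `<=` iter k (smul [set` xs]) L.
Proof.
by move=> hL; apply: smul_sub; case: (graded_iter_smul xs hL) => hG _; exact: (hG k).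
Qed.

Lemma iter_smul_le xs (L : set V) k l : is_submod L -> (k <= l)%N ->
  iter l (smul [set` xs]) L `<=` iter k (smul [set` xs]) L.
Proof.
move=> hL; elim: l => [|l IHl]; first by rewrite leqn0 => /eqP->.
rewrite leq_eqVlt => /orP[/eqP->//|]; rewrite ltnS => /IHl.
by apply: subset_trans; exact: iter_smulS.
Qed.

Lemma iter_smul_sub xs (L : set V) k : is_submod L -> iter k (smul [set` xs]) L `<=` L.
Proof. by move=> hL; exact: (@iter_smul_le xs L 0%N k hL (leq0n k)). Qed.

(** The pair G_k, G_(k+1) encodes the associated graded module of the filtration, which is generated
    in degree 0. Its lengths are the differences of the lengths of L/G_k, whence the extra
    degree. *)
Lemma polyfun_iter_smul xs (L : set V) : (forall S : set V, is_submod S -> fingen S) ->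
  is_submod L -> (forall k, flen L (iter k (smul [set` xs]) L)) ->
  polyfun (size xs).+1 (fun k => (len L (iter k (smul [set` xs]) L))%:R : R).
Proof.
move=> nV hL fl; pose G k := iter k (smul [set` xs]) L.
have gG : graded xs G by exact: graded_iter_smul.
have [hG Gx] := gG.
have gG' : graded xs (G \o S) by split=> [n|x n v xxs]; [exact: hG|exact: Gx].
have GS n : G n.+1 `<=` G n by exact: iter_smulS.
have flG n : flen (G n) (G n.+1).
  exact: flen_sub hL (fl n.+1) (@iter_smul_sub xs L n hL) (@subset_refl _ _).
have pG : polyfun (size xs) (fun n => (len (G n) (G n.+1))%:R : R).
  apply: (hilbert_serre gG gG') => //; apply: hilbert_basis => //.
  by exists 0%N => n _ v Gv; apply: sumsetl => //; exact: (submod0 (hG n.+2)).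
apply: polyfun_sum; apply: polyfun_ext pG; exists 0%N => n _.
rewrite -/(G n.+1) -/(G n) (lenD hL (hG n) (@GS n) (@iter_smul_sub xs L n hL) (fl n.+1)).
by rewrite natrD addrAC subrr add0r.
Qed.

End HilbertSerre.

Section Growth.
Variable R : realType.
Implicit Types f : nat -> R.

Lemma polyfun_shiftn s f k : polyfun s f -> polyfun s (fun n => f (n + k)%N).
Proof.
move=> pf; elim: k => [|k IHk].
  by apply: polyfun_ext pf; exists 0%N => n _; rewrite addn0.
by apply: polyfun_ext (polyfun_shift IHk); exists 0%N => n _; rewrite addSnnS.
Qed.

Lemma polyfun_diffn s f k : polyfun s.+1 f -> polyfun s (fun n => f (n + k)%N - f n).
Proof.
move=> pf; elim: k => [|k IHk].
  by exists 0%N, (fun=> 0) => n _; rewrite addn0 subrr big1// => j _; rewrite mul0r.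
have := polyfunD (polyfun_diff (polyfun_shiftn k pf)) IHk.
by apply: polyfun_ext; exists 0%N => n _; rewrite addrA subrK addSnnS.
Qed.

Lemma bigOn_shift t f k : bigOn t (fun n => f (n + k)%N) -> bigOn t f.
Proof.
move=> [C [n0 fC]]; exists `|C|, (n0 + k)%N => n n0n.
have kn : (k <= n)%N by rewrite (leq_trans _ n0n)// leq_addl.
have := fC (n - k)%N; rewrite subnK// leq_subRL// addnC => /(_ n0n)/andP[-> fn] /=.
apply: le_trans fn _; apply: (@le_trans _ _ (`|C| * (n - k)%:R ^+ t)).
  by apply: ler_wpM2r; [rewrite exprn_ge0|exact: ler_norm].
by apply: ler_wpM2l => //; rewrite lerXn2r ?nnegrE// ler_nat leq_subr.
Qed.

Lemma bigOn_le t f g : (exists n0, forall n, (n0 <= n)%N -> 0 <= f n <= g n) ->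
  bigOn t g -> bigOn t f.
Proof.
move=> [n1 fg] [C [n0 gC]]; exists C, (maxn n0 n1) => n.
rewrite geq_max => /andP[/gC/andP[_ gn] /fg/andP[-> fn]] /=.
exact: le_trans gn.
Qed.

End Growth.

(** * Polynomial growth of the lengths of (L ∩ F_n V)/F_n L *)

Section TorLengthGrowth.
Variables (R : realType) (A : comNzRingType) (m : set A) (d : nat)
  (I : set A) (F : int -> set A) (V : lmodType A) (L : set V).
Hypotheses (A_local : noetherian_local m) (A_CM : cohen_macaulay m)
  (A_dim : krull_dim A d) (d_ge1 : (1 <= d)%N) (I_primary : primary_to m I)
  (F_admissible : admissible I F) (fV : fingen [set: V]) (hL : is_submod L).

Let nA : noetherian A. Proof. by case: A_local. Qed.
Let mmax : maximal_ideal m. Proof. by case: A_local => _ locm; exact/locm. Qed.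
Let hI : is_ideal I. Proof. by case: I_primary => -[]. Qed.
Let hF n : is_ideal (F n). Proof. by case: F_admissible. Qed.

Lemma fingen_noetherian (S : set V) : is_submod S -> fingen S.
Proof. by move=> hS; exact: (fingen_sub nA fV hS (@subsetT _ S)). Qed.

Lemma ideal_expS k x y : ideal_exp I k x -> I y -> ideal_exp I k.+1 (y * x).
Proof. by move=> Ix Iy; exact: (@mem_smul A A^o I _ y x). Qed.

Lemma ideal_exp_pow k x : I x -> ideal_exp I k (x ^+ k).
Proof.
by move=> Ix; elim: k => [//|k IHk]; rewrite exprS; exact: ideal_expS.
Qed.

Lemma sub_F1 : I `<=` F 1.
Proof.
case: F_admissible => _ IF _ _ x Ix; apply: (IF 1).
by rewrite -[x]mulr1; exact: ideal_expS.
Qed.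

Lemma F_mul n x a : I x -> F n%:Z a -> F n.+1%:Z (x * a).
Proof.
move=> /sub_F1 Fx Fa; have [_ _ FM _] := F_admissible.
have -> : n.+1%:Z = 1 + n%:Z by rewrite intS.
by apply: FM; exact: (@mem_smul A A^o (F 1) _ x a).
Qed.

Lemma smul_F_mul n x (X : set V) v : I x -> smul (F n%:Z) X v ->
  smul (F n.+1%:Z) X (x *: v).
Proof.
move=> Ix; move: v; change (smul (F n%:Z) X `<=` (fun v => x *: v) @^-1` smul (F n.+1%:Z) X).
apply: smul_min.
  by apply: submod_preimage; [exact: scale_linear|exact: smul_submod].
move=> a v Fa Xv; rewrite /preimage /= scalerA.
by apply: mem_smul => //; exact: F_mul.
Qed.

Lemma m_pow_F n x : m x -> exists e, F n%:Z (x ^+ e).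
Proof.
case: I_primary => _ <- [e Ie]; exists (e * n)%N; rewrite exprM.
by case: F_admissible => _ IF _ _; apply: (IF n); exact: ideal_exp_pow.
Qed.

Definition tor_filtration n : set V := L `&` smul (F n%:Z) setT.

Lemma submod_tor_filtration n : is_submod (tor_filtration n).
Proof. by apply: submodI => //; exact: smul_submod. Qed.

Lemma smul_F_tor_filtration n : smul (F n%:Z) L `<=` tor_filtration n.
Proof. by move=> v Lv; split; [exact: smul_sub Lv|exact: smulS Lv]. Qed.

Lemma flen_tor_filtration n : flen (tor_filtration n) (smul (F n%:Z) L).
Proof.
apply: (flen_nilpotent nA mmax); first exact: submod_tor_filtration.
- exact: smul_submod.
- exact: smul_F_tor_filtration.
- by apply: fingen_noetherian; exact: submod_tor_filtration.
move=> x /(m_pow_F n)[e Fe]; exists e => z [Lz _]; exact: mem_smul.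
Qed.

Lemma flen_iter_smul (zs : seq A) k :
  (forall x, m x -> exists e, @lspan A A^o [set` zs] (x ^+ e)) ->
  flen L (iter k (smul [set` zs]) L).
Proof.
move=> mzs; have [hG _] := graded_iter_smul zs hL.
apply: (flen_nilpotent nA mmax) => //; first exact: iter_smul_sub.
  exact: fingen_noetherian.
move=> x /mzs[e xe]; exists (e * k)%N => z Lz; rewrite exprM.
elim: k => [|k IHk]; first by rewrite expr0 scale1r.
rewrite exprS -scalerA /= -smul_lspan; last exact: hG.
exact: mem_smul.
Qed.

Theorem polyfun_tor_filtration :
  polyfun d (fun n => (len (tor_filtration n) (smul (F n%:Z) L))%:R : R).
Proof.
have [ys Iys] := nA hI.
have Iy y : y \in ys -> I y by move=> yys; rewrite Iys; exact: sub_lspan.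
have smulI (S : set V) : is_submod S -> smul I S = smul [set` ys] S.
  by move=> hS; rewrite Iys smul_lspan.
pose M n := smul (F n%:Z) [set: V]; pose U n := smul (F n%:Z) L.
have gM : graded ys M by split=> [n|y n v /Iy]; [exact: smul_submod|exact: smul_F_mul].
have gU : graded ys U by split=> [n|y n v /Iy]; [exact: smul_submod|exact: smul_F_mul].
have gW : graded ys tor_filtration.
  split=> [n|y n v /Iy Iy' [Lv Mv]]; first exact: submod_tor_filtration.
  by split; [exact: submodZ|exact: smul_F_mul].
pose Z (n : nat) : set V := [set 0].
have gZ : graded ys Z.
  by split=> [n|y n v _ ->]; [exact: submod_zero|exact: scaler0].
have stM : stable ys M Z.
  case: F_admissible => _ _ _ [n0 _ Fn]; exists n0 => n n0n v.
  rewrite /M Fn; last by rewrite /= leqW.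
  have -> : n.+1%:Z - 1 = n%:Z by rewrite -addn1 PoszD addrK.
  rewrite smulA smulI; last exact: smul_submod.
  by move=> Mv; apply: sumsetl => //; exact: (submod0 (smul_submod _ _)).
(* Noetherianity of the Rees-type module, the sum of the F_n V, is used twice: for Artin-Rees, and
   as the hypothesis of Hilbert-Serre for the subquotients (L ∩ F_n V)/F_n L. *)
have nM : noethpair ys M Z.
  apply: hilbert_basis => //; first exact: fingen_noetherian.
  by move=> n _ ->; exact: (submod0 (smul_submod _ _)).
have W0 n : Z n `<=` tor_filtration n by move=> _ ->; exact: (submod0 (submod_tor_filtration n)).
have WM n : tor_filtration n `<=` M n by move=> v [].
(* Artin-Rees: L ∩ F_(n+1) V = I (L ∩ F_n V) for n >= n1. This n1 is the constant by which the
   filtrations differ below. *)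
have [n1 Wst] := nM _ gW W0 WM.
have pf : polyfun (size ys) (fun n => (len (tor_filtration n) (U n))%:R : R).
  apply: (hilbert_serre R gW gU); first exact: smul_F_tor_filtration.
    move=> Y gY UY YW; have [||n0 Yst] := nM _ gY.
    - by move=> n _ ->; have [hY _] := gY; exact: (submod0 (hY n)).
    - by move=> n; exact: subset_trans (YW n) (WM n).
    exists n0 => n n0n v /(Yst _ n0n)[t Yt vt]; exists t => //.
    by rewrite vt; case: gU => hU _; exact: (submod0 (hU n.+1)).
  exact: flen_tor_filtration.
have [qs [sqs qI qm]] := parameters A_local A_dim A_CM I_primary.
pose G k := iter k (smul [set` ys]) L; pose P k := iter k (smul [set` qs]) L.
have flG k : flen L (G k).
  apply: flen_iter_smul => x; case: I_primary => _ <- [e Ie].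
  by exists e; rewrite -Iys.
have flP k : flen L (P k) by exact: flen_iter_smul.
have [hG _] := graded_iter_smul ys hL; have [hP _] := graded_iter_smul qs hL.
have pH := polyfun_iter_smul R fingen_noetherian hL flG.
have pP := polyfun_iter_smul R fingen_noetherian hL flP.
rewrite sqs in pP.
have PG k : P k `<=` G k.
  elim: k => [//|k IHk]; rewrite /G iterS -smulI; last exact: hG.
  by apply: smulS => //; exact: qI.
(* The generators [ys] of I only bound the degree by their number. Since the ideal of the d
   parameters lies in I, L/I^k L is a quotient of L/P_k, whose length grows with degree at most
   d. *)
have {}pH : polyfun d.+1 (fun k => (len L (G k))%:R : R).
  apply: bigOn_polyfun pH _; apply: bigOn_le (polyfun_bigO pP _); last by [].
  exists 0%N => k _; rewrite ler0n ler_nat.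
  exact: (len_le hL (hG k) hL (@PG k) (@iter_smul_sub _ _ ys L k hL) (@subset_refl _ L) (flP k)).
have {pH} pg := polyfun_diffn n1 pH.
(* With n = k + n1 there are inclusions I^n L ⊆ F_n L ⊆ L ∩ F_n V ⊆ I^k L, the last one by
   Artin-Rees. *)
have fg k : (len (tor_filtration (k + n1)) (U (k + n1)) <= len (G k) (G (k + n1)))%N.
  have WG : tor_filtration (k + n1) `<=` G k.
    elim: k => [|k IHk]; first by move=> v [].
    rewrite addSn => v /Wst[|t Wt]; first by rewrite leq_addl.
    move=> vt; have -> : v = t by apply/eqP; rewrite -subr_eq0; exact/eqP.
    exact: smulS Wt.
  have GU n : G n `<=` U n.
    elim: n => [|n IHn]; last first.
      apply: smul_min => [|y v /= /Iy Iy' /IHn]; first exact: smul_submod.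
      exact: smul_F_mul.
    move=> v Lv; rewrite -[v]scale1r; apply: mem_smul => //.
    by case: F_admissible => _ IF _ _; exact: (IF 0).
  have flGG : flen (G k) (G (k + n1)%N).
    exact: flen_sub hL (flG _) (@iter_smul_sub _ _ ys L k hL) (@subset_refl _ _).
  exact: (len_le (@submod_tor_filtration _) (smul_submod _ _) (hG k) (GU _)
    (@smul_F_tor_filtration _) WG flGG).
case: d d_ge1 pg => [//|d'] _ pg.
apply: bigOn_polyfun pf _; apply: (@bigOn_shift _ _ _ n1).
have HB k : ((len (G k) (G (k + n1)))%:R : R) = (len L (G (k + n1)%N))%:R - (len L (G k))%:R.
  have GG : G (k + n1)%N `<=` G k by exact: (iter_smul_le hL (leq_addr _ _)).
  rewrite (lenD hL (hG k) GG (@iter_smul_sub _ _ ys L k hL) (flG _)).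
  by rewrite natrD addrAC subrr add0r.
apply: bigOn_le (polyfun_bigO pg _); last by move=> n; rewrite -HB ler0n.
by exists 0%N => n _; rewrite ler0n -HB ler_nat fg.
Qed.

End TorLengthGrowth.

(** * Computation of Tor_1 *)

Section PairMaps.
Variables (A : comNzRingType) (P Q : lmodType A).

Lemma fst_linear : linear (fst : P * Q -> P). Proof. by []. Qed.

Lemma snd_linear : linear (snd : P * Q -> Q). Proof. by []. Qed.

Lemma pairl_linear : linear (fun a : P => (a, 0) : (P * Q)%type).
Proof. by move=> c x y; apply: injective_projections; rewrite /= ?scaler0 ?addr0. Qed.

Lemma pairr_linear : linear (fun b : Q => (0, b) : (P * Q)%type).
Proof. by move=> c x y; apply: injective_projections; rewrite /= ?scaler0 ?addr0. Qed.

End PairMaps.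

Section SameLength.
Variable A : comNzRingType.

(** Finiteness is part of the relation because [len] is 0 on unbounded chains, so that equality of
    [len] alone would not transport it. *)
Definition same_len (V W : lmodType A) (Z B : set V) (Z' B' : set W) : Prop :=
  (flen Z B <-> flen Z' B') /\ len Z B = len Z' B'.

Lemma same_len_sym (V W : lmodType A) (Z B : set V) (Z' B' : set W) :
  same_len Z B Z' B' -> same_len Z' B' Z B.
Proof. by case=> fl l; split; [split=> /fl|rewrite l]. Qed.

Lemma same_len_trans (V W X : lmodType A) (Z B : set V) (Z' B' : set W) (Z'' B'' : set X) :
  same_len Z B Z' B' -> same_len Z' B' Z'' B'' -> same_len Z B Z'' B''.
Proof.
move=> [fl l] [fl' l']; split; last by rewrite l.
by split=> [/fl/fl'|/fl'/fl].
Qed.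

(* The hypotheses say that f induces an isomorphism from Z / B to Z' / B'. *)
Lemma same_len_map (V W : lmodType A) (f : V -> W) (Z B : set V) (Z' B' : set W) :
  linear f -> is_submod Z -> is_submod Z' -> is_submod B' ->
  (forall v, Z v -> Z' (f v)) -> B' `<=` Z' ->
  (forall w, Z' w -> exists2 v, Z v & B' (w - f v)) ->
  (forall v, Z v -> B' (f v) -> B v) -> (forall v, B v -> Z v /\ B' (f v)) ->
  same_len Z B Z' B'.
Proof.
move=> lf hZ hZ' hB' fZ BZ' Zf fB Bf.
have ZE : Z' = sumset (f @` Z) B'.
  apply/seteqP; split.
    by move=> w /Zf[v Zv Bw]; exists (f v) => //; exists v.
  by apply: sumset_min => // _ [v /fZ ? <-].
have BE : B = Z `&` f @^-1` B'.
  by apply/seteqP; split=> [v /Bf//|v [Zv Bv]]; exact: fB.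
rewrite ZE BE; split; last by rewrite (len_map lf).
by rewrite (flen_map lf).
Qed.

End SameLength.

Section ModuleLength.
Variables (R : realType) (A : comNzRingType).

Lemma submod_chainP (V : lmodType A) n : submod_chain V n <-> mchain [set (0 : V)] n setT.
Proof.
have s0 (W : set V) : is_submod W -> [set 0] `<=` W by move=> hW _ ->; exact: submod0.
split=> [[W [hW WW]]|c].
  have c i : (i <= n)%N -> mchain [set (0 : V)] i (W i).
    elim: i => [|i IHi] ni; first exact: mchain0 (hW _ ni) (s0 _ (hW _ ni)).
    by apply: mchainS (IHi (ltnW ni)) _ (hW _ ni); exact: WW.
  exact: mchain_mono (c n (leqnn n)) (@subsetT _ _) (submodT V).
have ind Z : mchain [set (0 : V)] n Z -> exists W : nat -> set V,
    [/\ W n = Z, forall i, (i <= n)%N -> is_submod (W i) &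
        forall i, (i < n)%N -> W i `<` W i.+1].
  elim: n Z {c} => [|n IHn] Z [hZ _].
    by move=> _; exists (fun=> Z); split.
  move=> [Z' /IHn[W [WE hW WW]] ZZ].
  exists (fun i => if (i <= n)%N then W i else Z); split.
  - by rewrite ltnn.
  - by move=> i _; case: ifP => // /hW.
  move=> i; rewrite ltnS => ni; rewrite ni; case: ltnP => [|ni']; first exact: WW.
  have /eqP -> : i == n by rewrite eqn_leq ni ni'.
  by rewrite WE.
by have [W [_ hW WW]] := ind _ c; exists W.
Qed.

Lemma fine_module_length (V : lmodType A) : flen setT [set (0 : V)] ->
  fine (module_length V R) = (len setT [set (0 : V)])%:R.
Proof.
move=> fl; have [c mx] := lenP (submodT V) (@subsetT _ _) fl.
suff -> : module_length V R = ((len setT [set (0 : V)])%:R)%:E by [].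
apply/eqP; rewrite eq_le; apply/andP; split.
  apply: ge_ereal_sup => _ [n /submod_chainP/mx nl <-].
  by rewrite lee_fin ler_nat.
by apply: ereal_sup_ubound; exists (len setT [set (0 : V)]) => //; exact/submod_chainP.
Qed.

Lemma quotmod_pi_linear (V : lmodType A) (S : set V) :
  linear (\pi_(quotmod S) : V -> quotmod S).
Proof. by move=> a x y; rewrite pi_addr pi_quotmod_scale. Qed.

Lemma quotmod_piP (V : lmodType A) (S : set V) x y :
  \pi_(quotmod S) x = \pi_(quotmod S) y <-> lspan S (x - y).
Proof.
split=> [/quotmod_eqP/asboolP//|Sxy]; apply/quotmod_eqP; exact/asboolP.
Qed.

Lemma quotmod_pi0 (V : lmodType A) (S : set V) x :
  \pi_(quotmod S) x = 0 <-> lspan S x.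
Proof.
rewrite -(lin0 (@quotmod_pi_linear V S)) (quotmod_piP S x 0).
by rewrite subr0.
Qed.

Lemma quotmod_lift (V W : lmodType A) (S : set V) (f : V -> W) : linear f ->
  (forall x, S x -> f x = 0) -> forall x, f (repr (\pi_(quotmod S) x)) = f x.
Proof.
move=> lf fS x; apply/eqP; rewrite -subr_eq0 -(linB lf); apply/eqP.
have : lspan S (repr (\pi_(quotmod S) x) - x) by apply/quotmod_piP; rewrite reprK.
have hk : is_submod (f @^-1` [set 0]) by apply: submod_preimage => //; exact: submod_zero.
exact: (lspan_min hk fS).
Qed.

Lemma val_submod_linear (V : lmodType A) (S : set V) : linear (val : submod S -> V).
Proof. by move=> a x y; rewrite linearP. Qed.

Lemma len_subquot (V : lmodType A) (Z B : set V) : is_submod Z -> is_submod B ->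
  B `<=` Z -> same_len [set: subquot Z B] [set 0] Z B.
Proof.
move=> hZ hB BZ; pose B1 : set (submod Z) := [set z | B (val z)].
have hB1 : is_submod B1 by exact: (submod_preimage (@val_submod_linear _ Z) hB).
have lZ z : z \in lspan_pred Z <-> Z z.
  by split=> [/asboolP|Zz]; [rewrite lspan_id|apply/asboolP; rewrite lspan_id].
apply: (@same_len_trans _ _ (submod Z) _ _ _ [set: submod Z] B1).
  apply: same_len_sym; apply: (same_len_map (f := \pi_(quotmod B1))) => //.
  - exact: quotmod_pi_linear.
  - exact: submod_zero.
  - by move=> w _; exists (repr w) => //; rewrite reprK subrr.
  - by move=> v _ /quotmod_pi0; rewrite lspan_id.
  - by move=> v Bv; split=> //; apply/quotmod_pi0; exact: sub_lspan.
apply: (same_len_map (f := val)) => //.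
- by move=> v _; apply/lZ; exact: valP.
- by move=> w /lZ Zw; exists (Sub w Zw) => //; rewrite SubK subrr; exact: submod0.
Qed.

End ModuleLength.

Section FreeModules.
Variables (A : comNzRingType) (X : choiceType).

Lemma free_genZ (a : A) (x : X) : Freeg [:: (a, x)] = a *: free_gen A x.
Proof.
apply/eqP/freeg_eqP => y; rewrite coeffZ !coeffU mul1r.
by [].
Qed.

Lemma free_gen_span (S : set {freeg X / A}) : is_submod S ->
  (forall x, S (free_gen A x)) -> forall r, S r.
Proof.
move=> hS Sx r; rewrite -(freeg_sumE r).
apply: (big_ind S); first exact: submod0.
  by move=> x y; exact: submodD.
by move=> x _; rewrite free_genZ; exact: submodZ.
Qed.

Lemma fglift_free_gen (V : lmodType A) (f : X -> V) x : fglift f (free_gen A x) = f x.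
Proof. by rewrite /free_gen liftU scale1r. Qed.

Lemma fglift_linear (V : lmodType A) (f : X -> V) : linear (fglift f).
Proof.
have subf : {morph fglift f : x y / x - y} := lift_is_additive f.
have f0 : fglift f 0 = 0 by rewrite -(subrr 0) subf subrr.
have addf : {morph fglift f : x y / x + y}.
  by move=> x y; rewrite -{1}(opprK y) -(sub0r y) !subf f0 sub0r opprK.
have scf a r : fglift f (a *: r) = a *: fglift f r.
  rewrite -(freeg_sumE r); elim: (dom r) => [|x s IHs].
    by rewrite !big_nil scaler0 f0 scaler0.
  rewrite !big_cons scalerDr !addf IHs scalerDr free_genZ scalerA -!free_genZ !liftU.
  by rewrite scalerA.
by move=> a x y; rewrite addf scf.
Qed.

End FreeModules.

Lemma range_fglift_ker (A : comNzRingType) (V W : lmodType A) (p : V -> W) : linear p ->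
  range (fglift (val : {x : V | p x == 0} -> V)) = [set x | p x = 0].
Proof.
move=> lp; set f := fglift _; have lf : linear f by exact: fglift_linear.
apply/seteqP; split=> [_ [r _ <-]|x /= px0].
  suff : forall r, [set r | p (f r) = 0] r by apply.
  apply: free_gen_span; last first.
    by case=> x px; rewrite /= /f fglift_free_gen; exact/eqP.
  apply: (@submod_preimage _ _ _ (p \o f) _ [set 0]); last exact: submod_zero.
  by move=> a x y /=; rewrite lf lp.
have px : p x == 0 by exact/eqP.
by exists (free_gen A (exist _ x px : {x : V | p x == 0})) => //; rewrite /f fglift_free_gen.
Qed.

(** * The tensor product with A/J *)

Section TensorQuotient.
Variables (A : comNzRingType) (J : set A).
Hypothesis hJ : is_ideal J.
Local Notation AJ := (@quotmod A A^o J).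
Local Notation piJ := (\pi_(@quotmod A A^o J) : A^o -> AJ).

Definition tens (U V : lmodType A) (u : U) (v : V) : tensor U V :=
  \pi_(quotmod (bilinear_rel (U := U) (V := V))) (free_gen A (u, v)).

Lemma tens_rel (U V : lmodType A) (r : {freeg (U * V)%type / A}) :
  bilinear_rel r -> \pi_(quotmod (bilinear_rel (U := U) (V := V))) r = 0.
Proof. by move=> Br; apply/quotmod_pi0; exact: sub_lspan. Qed.

Lemma tens_linearl (U V : lmodType A) (v : V) : linear (fun u : U => tens u v).
Proof.
move=> a u u'; have lpi := @quotmod_pi_linear _ _ (bilinear_rel (U := U) (V := V)).
rewrite /tens.
have := @tens_rel U V _ (Or41 _ _ _ (ex_intro _ (a *: u) (ex_intro _ u' (ex_intro _ v erefl)))).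
rewrite !(linB lpi) => /eqP; rewrite !subr_eq add0r => /eqP ->.
have := @tens_rel U V _ (Or43 _ _ _ (ex_intro _ a (ex_intro _ u (ex_intro _ v erefl)))).
by rewrite (linB lpi) (linZ lpi) => /eqP; rewrite subr_eq0 => /eqP ->; rewrite addrC.
Qed.

Lemma tens_linearr (U V : lmodType A) (u : U) : linear (fun v : V => tens u v).
Proof.
move=> a v v'; have lpi := @quotmod_pi_linear _ _ (bilinear_rel (U := U) (V := V)).
rewrite /tens.
have := @tens_rel U V _ (Or42 _ _ _ (ex_intro _ u (ex_intro _ (a *: v) (ex_intro _ v' erefl)))).
rewrite !(linB lpi) => /eqP; rewrite !subr_eq add0r => /eqP ->.
have := @tens_rel U V _ (Or44 _ _ _ (ex_intro _ a (ex_intro _ u (ex_intro _ v erefl)))).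
by rewrite (linB lpi) (linZ lpi) => /eqP; rewrite subr_eq0 => /eqP ->; rewrite addrC.
Qed.

(** A bilinear f kills the four kinds of relations, so its extension to the free module does not
    depend on the representative: this is the universal property of the tensor product. *)
Lemma tensor_lift (U V W : lmodType A) (f : U * V -> W) :
  (forall v, linear (fun u => f (u, v))) -> (forall u, linear (fun v => f (u, v))) ->
  forall r, fglift f (repr (\pi_(quotmod (bilinear_rel (U := U) (V := V))) r)) = fglift f r.
Proof.
move=> lfl lfr; have lf := @fglift_linear A _ W f.
apply: quotmod_lift => // r [|||].
- move=> [u [u' [v ->]]]; rewrite !(linB lf) !fglift_free_gen.
  by rewrite (linD (lfl v)) addrAC addrK subrr.
- move=> [u [v [v' ->]]]; rewrite !(linB lf) !fglift_free_gen.
  by rewrite (linD (lfr u)) addrAC addrK subrr.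
- move=> [a [u [v ->]]]; rewrite (linB lf) (linZ lf) !fglift_free_gen.
  by rewrite (linZ (lfl v)) subrr.
- move=> [a [u [v ->]]]; rewrite (linB lf) (linZ lf) !fglift_free_gen.
  by rewrite (linZ (lfr u)) subrr.
Qed.

Lemma tensor_map_tens (U U' V : lmodType A) (f : U -> U') u v : linear f ->
  tensor_map f (tens u v) = tens (f u) v :> tensor U' V.
Proof.
move=> lf; rewrite /tensor_map /tens.
have lpi := @quotmod_pi_linear _ _ (bilinear_rel (U := U') (V := V)).
have lg := @fglift_linear A _ _ (fun p : U * V => free_gen A (f p.1, p.2)).
rewrite (@quotmod_lift _ _ _ (bilinear_rel (U := U) (V := V))
  (fun r => \pi_(quotmod (bilinear_rel (U := U') (V := V)))
     (fglift (fun p : U * V => free_gen A (f p.1, p.2)) r))).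
- by rewrite fglift_free_gen.
- by move=> a x y; rewrite lg lpi.
move=> r; rewrite /= => -[|||].
- move=> [x [x' [y ->]]]; rewrite !(linB lg) !fglift_free_gen /= !(linB lpi).
  by rewrite -!/(tens _ _) (linD lf) (linD (tens_linearl y)) addrAC addrK subrr.
- move=> [x [y [y' ->]]]; rewrite !(linB lg) !fglift_free_gen /= !(linB lpi).
  by rewrite -!/(tens _ _) (linD (tens_linearr (f x))) addrAC addrK subrr.
- move=> [a [x [y ->]]]; rewrite (linB lg) (linZ lg) !fglift_free_gen /= (linB lpi) (linZ lpi).
  by rewrite -!/(tens _ _) (linZ lf) (linZ (tens_linearl y)) subrr.
- move=> [a [x [y ->]]]; rewrite (linB lg) (linZ lg) !fglift_free_gen /= (linB lpi) (linZ lpi).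
  by rewrite -!/(tens _ _) (linZ (tens_linearr (f x))) subrr.
Qed.

(** Together [tens1_surj] and [tens1_ker] say that this map induces an isomorphism from U/JU to U ⊗
    A/J. *)
Definition tens1 (U : lmodType A) (u : U) : tensor U AJ := tens u (piJ 1).

Lemma piJE (a : A) : piJ a = a *: piJ 1.
Proof. by rewrite -[RHS](linZ (@quotmod_pi_linear _ A^o J)) [a *: _]mulr1. Qed.

Lemma tensE (U : lmodType A) (u : U) (a : A) : tens u (piJ a) = tens1 (a *: u).
Proof.
by rewrite piJE (linZ (@tens_linearr U AJ u)) -(linZ (@tens_linearl U AJ (piJ 1))).
Qed.

Lemma tens1_linear (U : lmodType A) : linear (@tens1 U).
Proof. exact: tens_linearl. Qed.

Lemma tens1_surj (U : lmodType A) (t : tensor U AJ) : exists u, t = tens1 u.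
Proof.
have lt := @tens1_linear U; have hT := submod_image lt (submodT U).
have lpi := @quotmod_pi_linear _ _ (bilinear_rel (U := U) (V := AJ)).
suff [u _ <-] : range (@tens1 U) t by exists u.
rewrite -[t]reprK; move: (repr t) => r {t}.
apply: (free_gen_span (submod_preimage lpi hT)) => -[u v].
by rewrite /preimage /= -/(tens u v) -[v]reprK tensE; exists ((repr v : A) *: u).
Qed.

Lemma tens1_ker (U : lmodType A) (u : U) : tens1 u = 0 <-> smul J setT u.
Proof.
split; last first.
  have hk : is_submod (@tens1 U @^-1` [set 0]).
    by apply: submod_preimage; [exact: tens1_linear|exact: submod_zero].
  move: u; apply: (smul_min hk) => a u Ja _; rewrite /preimage /= -tensE.
  have -> : piJ a = 0 by apply/(@quotmod_pi0 A A^o J); exact: sub_lspan.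
  exact: (lin0 (@tens_linearr U AJ u)).
pose S := smul J [set: U]; have hS : is_submod S by exact: smul_submod.
have lpi := @quotmod_pi_linear _ _ S.
have JS (a : A) x : J a -> \pi_(quotmod S) (a *: x) = 0.
  by move=> Ja; apply/quotmod_pi0; rewrite lspan_id//; exact: mem_smul.
have reprJ (a b : A) : piJ a = piJ b -> J (a - b).
  by move/(@quotmod_piP A A^o J a b); rewrite (@lspan_id A A^o J).
have pieq (a b : A) x : piJ a = piJ b -> \pi_(quotmod S) (a *: x) = \pi_(quotmod S) (b *: x).
  by move=> /reprJ Jab; apply/quotmod_piP; rewrite -scalerBl lspan_id//; exact: mem_smul.
have lJ := @quotmod_pi_linear _ A^o J.
(* The bilinear map sending u and the class of a to the class of a u in U/JU. By [tensor_lift] it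
   recovers the class of u from [tens1 u]. *)
pose f (p : U * AJ) : quotmod S := \pi_(quotmod S) ((repr p.2 : A) *: p.1).
have fl v : linear (fun u => f (u, v)).
  by move=> a x y; rewrite /f /= scalerDr (linD lpi) scalerA mulrC -scalerA (linZ lpi).
have fr x : linear (fun v => f (x, v)).
  move=> a v w; rewrite /f /= -(linZ lpi) -(linD lpi) scalerA -scalerDl; apply: pieq.
  rewrite reprK; apply/esym.
  have := lJ a (repr v) (repr w); rewrite !reprK; exact.
have := tensor_lift fl fr (free_gen A (u, piJ 1)).
rewrite -/(tens u (piJ 1)) -/(tens1 u) fglift_free_gen => fE t0.
have : f (u, piJ 1) = 0.
  rewrite -fE t0.
  have /= := tensor_lift fl fr 0.
  rewrite (lin0 (@quotmod_pi_linear _ _ (bilinear_rel (U := U) (V := AJ)))) => ->.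
  exact: (lin0 (@fglift_linear A _ _ f)).
rewrite /f /= (@pieq _ 1); last by rewrite reprK.
by rewrite scale1r => /quotmod_pi0; rewrite lspan_id.
Qed.

Lemma tensor_map1 (U U' : lmodType A) (f : U -> U') u : linear f ->
  tensor_map f (tens1 u) = tens1 (f u).
Proof. exact: tensor_map_tens. Qed.

End TensorQuotient.

(** * Tor_1 from a projective cover *)

Section TorLength.
Variables (A : comNzRingType).

Definition ker (V W : lmodType A) (p : V -> W) : set V := [set x | p x = 0].

Lemma submod_ker (V W : lmodType A) (p : V -> W) : linear p -> is_submod (ker p).
Proof. by move=> lp; exact: (submod_preimage lp (submod_zero W)). Qed.

Definition tor_cycles (V W : lmodType A) (p : V -> W) (J : set A) : set V :=
  ker p `&` smul J setT.

Definition tor_boundaries (V W : lmodType A) (p : V -> W) (J : set A) : set V :=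
  smul J (ker p).

Lemma submod_tor_cycles (V W : lmodType A) (p : V -> W) J : linear p ->
  is_submod (tor_cycles p J).
Proof. by move=> lp; apply: submodI; [exact: submod_ker|exact: smul_submod]. Qed.

Lemma tor_boundaries_cycles (V W : lmodType A) (p : V -> W) J : linear p ->
  tor_boundaries p J `<=` tor_cycles p J.
Proof.
by move=> lp x Bx; split; [apply: smul_sub Bx; exact: submod_ker|exact: smulS Bx].
Qed.

Lemma res_d0_linear (U : lmodType A) : linear (@res_d0 A U).
Proof. exact: fglift_linear. Qed.

Lemma res_d1_linear (U : lmodType A) : linear (@res_d1 A U).
Proof. exact: fglift_linear. Qed.

Lemma res_d2_linear (U : lmodType A) : linear (@res_d2 A U).
Proof. exact: fglift_linear. Qed.

Lemma range_res_d1 (U : lmodType A) : range (@res_d1 A U) = ker (@res_d0 A U).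
Proof. exact/range_fglift_ker/res_d0_linear. Qed.

Lemma range_res_d2 (U : lmodType A) : range (@res_d2 A U) = ker (@res_d1 A U).
Proof. exact/range_fglift_ker/res_d1_linear. Qed.

Lemma res_d0_surj (U : lmodType A) (u : U) : exists x, res_d0 x = u.
Proof. by exists (free_gen A u); exact: fglift_free_gen. Qed.

(** Along [tens1], the homology at [res1] becomes Z/B with Z the elements that d1 sends into J
    [res0], and B = J [res1] + im d2. As im d2 = ker d1, the map d1 carries Z/B isomorphically onto
    the quotient of ker d0 ∩ J [res0] by J ker d0. *)
Lemma tor1_length (U : lmodType A) (J : set A) : is_ideal J ->
  same_len [set: Tor1 U (@quotmod A A^o J)] [set 0]
    (tor_cycles (@res_d0 A U) J) (tor_boundaries (@res_d0 A U) J).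
Proof.
move=> hJ; set AJ := @quotmod A A^o J.
have ld1 := @res_d1_linear U; have ld2 := @res_d2_linear U; have ld0 := @res_d0_linear U.
pose t1 := @tens1 A J (res1 U); have lt1 : linear t1 by exact: tens1_linear.
have lmap (V W : lmodType A) (f : V -> W) : linear f ->
    linear (tensor_map f : tensor V AJ -> tensor W AJ).
  move=> lf a x y; have [u ->] := tens1_surj x; have [v ->] := tens1_surj y.
  by rewrite -tens1_linear !tensor_map1// lf tens1_linear.
have d12 x : res_d1 (res_d2 x) = 0 :> res0 U.
  have : range (@res_d2 A U) (res_d2 x) by exists x.
  by rewrite range_res_d2.
pose Zt := [set x : tensor (res1 U) AJ | tensor_map (@res_d1 A U) x = 0].
pose Bt := range (@tensor_map _ _ _ AJ (@res_d2 A U)).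
have hZt : is_submod Zt by exact: (submod_preimage (lmap _ _ _ ld1) (submod_zero _)).
have hBt : is_submod Bt by apply: (submod_image (lmap _ _ _ ld2)); exact: submodT.
have BZt : Bt `<=` Zt.
  move=> _ [t _ <-]; have [u ->] := tens1_surj t.
  by rewrite /Zt /= !tensor_map1// d12 (lin0 (@tens1_linear _ _ _)).
apply: same_len_trans (len_subquot hZt hBt BZt) _.
pose Z : set (res1 U) := (@res_d1 A U) @^-1` smul J setT.
have hZ : is_submod Z by apply: submod_preimage => //; exact: smul_submod.
pose B := Z `&` t1 @^-1` Bt.
have ZtE u : Zt (t1 u) <-> Z u by rewrite /Zt /= tensor_map1// tens1_ker.
have BE u : B u <-> exists v, smul J setT (u - res_d2 v).
  split=> [[_ [t _ tu]]|[v Ju]].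
    have [v vE] := tens1_surj t; exists v; apply/tens1_ker => //.
    by rewrite (linB (@tens1_linear _ _ _)) -tensor_map1// -vE tu subrr.
  have tE : t1 u = tens1 J (res_d2 v).
    by apply/eqP; rewrite -subr_eq0 -(linB lt1); apply/eqP/tens1_ker.
  have Bu : Bt (t1 u) by rewrite tE -tensor_map1//; exists (tens1 J v).
  by split=> //; apply/ZtE/BZt.
apply: (@same_len_trans _ _ (res1 U) _ _ _ Z B).
  apply: same_len_sym; apply: (same_len_map (f := t1)) => //.
  - by move=> v /ZtE.
  - move=> w Zw; have [u uE] := tens1_surj w; exists u.
      by apply/ZtE; rewrite /t1 -uE.
    by rewrite uE subrr; exact: (submod0 hBt).
have dJ : @res_d1 A U @` smul J setT = tor_boundaries (@res_d0 A U) J.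
  by rewrite (image_smul _ _ ld1) range_res_d1.
apply: (same_len_map (f := @res_d1 A U)) => //.
- exact: submod_tor_cycles.
- exact: smul_submod.
- by move=> v Zv; split=> //; rewrite -range_res_d1; exists v.
- exact: tor_boundaries_cycles.
- move=> w [+ Jw]; rewrite -range_res_d1 => -[v _ vE]; exists v.
    by rewrite /Z /preimage /= vE.
  by rewrite vE subrr; exact: (submod0 (smul_submod _ _)).
- move=> v Zv; rewrite -dJ => -[w Jw wE]; apply/BE.
  have : ker (@res_d1 A U) (v - w) by rewrite /ker /= (linB ld1) wE subrr.
  by rewrite -range_res_d2 => -[x _ xE]; exists x; rewrite xE subKr.
move=> v Bv; split; first by case: Bv.
have [x Jvx] := (BE v).1 Bv; rewrite -dJ; exists (v - res_d2 x) => //.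
by rewrite (linB ld1) d12 subr0.
Qed.

Definition projective (Q : lmodType A) : Prop :=
  forall (V W : lmodType A) (g : V -> W) (f : Q -> W), linear g -> linear f ->
    (forall w, exists v, g v = w) -> exists2 h : Q -> V, linear h & forall q, g (h q) = f q.

Lemma projective_free (X : choiceType) : projective {freeg X / A}.
Proof.
move=> V W g f lg lf gs.
have [h0 hE] := choice (fun x : X => gs (f (free_gen A x))).
exists (fglift h0); first exact: fglift_linear.
apply: (@free_gen_span _ _ [set q | g (fglift h0 q) = f q]); last first.
  by move=> x; rewrite /= fglift_free_gen.
have lh := @fglift_linear A X V h0; split=> /=.
- by rewrite (lin0 lh) (lin0 lg) (lin0 lf).
- by move=> x y xE yE; rewrite (linD lh) (linD lg) (linD lf) xE yE.
- by move=> a x xE; rewrite (linZ lh) (linZ lg) (linZ lf) xE.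
Qed.

Lemma projective_prod (Q Q' : lmodType A) : projective Q -> projective Q' ->
  projective (Q * Q')%type.
Proof.
move=> pQ pQ' V W g f lg lf gs.
have li := @pairl_linear A Q Q'; have li' := @pairr_linear A Q Q'.
have [|h lh hE] := pQ V W g (fun a => f (a, 0)) lg _ gs.
  by move=> c x y; rewrite li lf.
have [|h' lh' hE'] := pQ' V W g (fun a => f (0, a)) lg _ gs.
  by move=> c x y; rewrite li' lf.
exists (fun q => h q.1 + h' q.2).
  by move=> c x y; rewrite /= lh lh' scalerDr addrACA.
move=> [a b] /=; rewrite (linD lg) hE hE' -(linD lf); congr f.
by apply: injective_projections; rewrite /= ?addr0 ?add0r.
Qed.

(* Schanuel: if h and k are maps over U, then kh - 1 and hk - 1 take values in
   the kernels, so they map JQ into J ker p and JP into J ker q. *)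
Lemma tor_cover (U Q P : lmodType A) (q : Q -> U) (p : P -> U) (J : set A) :
  projective Q -> projective P -> linear q -> linear p ->
  (forall u, exists x, q x = u) -> (forall u, exists x, p x = u) ->
  same_len (tor_cycles q J) (tor_boundaries q J) (tor_cycles p J) (tor_boundaries p J).
Proof.
move=> pQ pP lq lp qs ps.
have [h lh hE] := pQ _ _ _ _ lp lq ps; have [k lk kE] := pP _ _ _ _ lq lp qs.
have imJ (V W W' : lmodType A) (f : V -> W) (g : W -> W') (S : set V) : linear f ->
    (forall x, S x -> g (f x) = 0) -> forall x, smul J S x -> smul J (ker g) (f x).
  move=> lf fS x Jx; have : (f @` smul J S) (f x) by exists x.
  by rewrite image_smul//; apply: smulS => // _ [y /fS ? <-].
have lkh : linear (fun x => k (h x) - x).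
  by move=> a x y; rewrite lh lk scalerBr opprD addrACA.
have lhk : linear (fun x => h (k x) - x).
  by move=> a x y; rewrite lk lh scalerBr opprD addrACA.
have khJ x : smul J setT x -> tor_boundaries q J (k (h x) - x).
  apply: (imJ _ _ _ (fun x => k (h x) - x) q setT lkh) => y _.
  by rewrite (linB lq) kE hE subrr.
have hkJ x : smul J setT x -> tor_boundaries p J (h (k x) - x).
  apply: (imJ _ _ _ (fun x => h (k x) - x) p setT lhk) => y _.
  by rewrite (linB lp) hE kE subrr.
have hT x : smul J setT x -> smul J setT (h x).
  move=> Jx; have : (h @` smul J setT) (h x) by exists x.
  by rewrite image_smul//; exact: smulS.
have kT x : smul J setT x -> smul J setT (k x).
  move=> Jx; have : (k @` smul J setT) (k x) by exists x.
  by rewrite image_smul//; exact: smulS.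
have hBp := @smul_submod A P J (ker p); have hBq := @smul_submod A Q J (ker q).
apply: (same_len_map lh).
- exact: submod_tor_cycles.
- exact: submod_tor_cycles.
- exact: smul_submod.
- by move=> v [qv Jv]; split; [rewrite /ker /= hE|exact: hT].
- exact: tor_boundaries_cycles.
- move=> w [pw Jw]; exists (k w); first by split; [rewrite /ker /= kE|exact: kT].
  by rewrite -opprB; apply: (submodN hBp); exact: hkJ.
- move=> v [qv Jv] Bhv; rewrite -(subKr (k (h v)) v); apply: (submodB hBq); last exact: khJ.
  by apply: (imJ _ _ _ k q (ker p) lk) Bhv => x px; rewrite kE.
- move=> v Bv; split; first exact: tor_boundaries_cycles.
  by apply: (imJ _ _ _ h p (ker q) lh) Bv => x qx; rewrite hE.
Qed.

(** The module [res0 U] is free on all elements of U. The finite free module obtained here is the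
    one to which the noetherian arguments apply, and [tor_cover] carries the lengths back. *)
Lemma fingen_cover (U : lmodType A) : fingen [set: U] -> exists n (q : {freeg 'I_n / A} -> U),
  linear q /\ forall u, exists x, q x = u.
Proof.
move=> [s sT]; exists (size s), (fglift (fun i : 'I_(size s) => s`_i)).
set q := fglift _; have lq : linear q by exact: fglift_linear.
split=> // u; suff [x _ <-] : range q u by exists x.
have : lspan [set` s] u by rewrite -sT.
apply: lspan_min; first exact/submod_image/submodT.
move=> v /= vs; have iv : (index v s < size s)%N by rewrite index_mem.
by exists (free_gen A (Ordinal iv)) => //; rewrite /q fglift_free_gen /= nth_index.
Qed.

Lemma fingen_free n : fingen [set: {freeg 'I_n / A}].
Proof.
exists [seq free_gen A i | i <- enum 'I_n]; apply/seteqP; split=> // r _.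
apply: free_gen_span => [|i]; first exact: lspan_is_submod.
by apply: sub_lspan; rewrite /= map_f// mem_enum.
Qed.

End TorLength.

(** * The defect of an extension *)

Section Lengths.
Variables (A : comNzRingType) (V : lmodType A).
Implicit Types Z B : set V.

(** The quotient (B + B')/B' is B/(B ∩ B'), hence a quotient of B/W. *)
Lemma len_join Z B B' W : is_submod Z -> is_submod B -> is_submod B' -> is_submod W ->
  W `<=` B -> W `<=` B' -> B `<=` Z -> B' `<=` Z -> flen Z W ->
  (len (sumset B B') W <= len B W + len B' W)%N.
Proof.
move=> hZ hB hB' hW WB WB' BZ BZ' fl.
have hS := submod_sum hB hB'; have SZ := sumset_min hZ BZ BZ'.
have flS := flen_sub hZ fl SZ (@subset_refl _ W).
have B'S : B' `<=` sumset B B' by apply: sumsetr; exact: submod0.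
rewrite (lenD hS hB' WB' B'S flS) leq_add2r.
have lid : linear (fun v : V => v) by [].
have BE : (fun v : V => v) @` B = B by rewrite image_id.
have := len_map lid hB hB'; rewrite BE => ->.
have WBB : W `<=` B `&` B' by move=> v Wv; split; [exact: WB|exact: WB'].
have flB := flen_sub hZ fl BZ (@subset_refl _ W).
exact: (len_le hB (submodI hB hB') hB WBB (@subIsetl _ B B') (@subset_refl _ B) flB).
Qed.

(** The quotient B/(B ∩ B') is (B + B')/B', hence contained in Z/B'. *)
Lemma len_meet Z B B' : is_submod Z -> is_submod B -> is_submod B' ->
  B `<=` Z -> B' `<=` Z -> flen Z (B `&` B') ->
  (len Z (B `&` B') <= len Z B + len Z B')%N.
Proof.
move=> hZ hB hB' BZ B'Z fl; have hI := submodI hB hB'.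
have IB : B `&` B' `<=` B by move=> v [].
have IB' : B `&` B' `<=` B' by move=> v [].
rewrite (lenD hZ hB IB BZ fl) leq_add2l.
have lid : linear (fun v : V => v) by [].
have BE : (fun v : V => v) @` B = B by rewrite image_id.
have <- : len (sumset B B') B' = len B (B `&` B').
  by have := len_map lid hB hB'; rewrite BE.
have flB := flen_sub hZ fl (@subset_refl _ Z) IB'.
have hS := submod_sum hB hB'; have B'S := sumsetr (T := B') (submod0 hB).
exact: (len_le hS hB' hZ (@subset_refl _ B') B'S (sumset_min hZ BZ B'Z) flB).
Qed.

End Lengths.

Section Pairs.
Variables (A : comNzRingType) (P Q : lmodType A).

Lemma smul_linear (J : set A) (V W : lmodType A) (f : V -> W) (X : set V) (Y : set W) :
  linear f -> (forall x, X x -> Y (f x)) -> forall x, smul J X x -> smul J Y (f x).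
Proof.
move=> lf fX x Jx; have : (f @` smul J X) (f x) by exists x.
by rewrite image_smul//; apply: smulS => // _ [y /fX ? <-].
Qed.

Lemma smul_pair (J : set A) (a : P) (b : Q) :
  smul J setT (a, b) <-> smul J setT a /\ smul J setT b.
Proof.
split=> [Jab|[Ja Jb]].
  split; first by apply: (smul_linear (@fst_linear A P Q) _ Jab).
  by apply: (smul_linear (@snd_linear A P Q) _ Jab).
have -> : (a, b) = (a, 0) + (0, b) :> (P * Q)%type.
  by apply: injective_projections; rewrite /= ?addr0 ?add0r.
apply: (submodD (smul_submod _ _)).
  by apply: (smul_linear (@pairl_linear A P Q) _ Ja).
by apply: (smul_linear (@pairr_linear A P Q) _ Jb).
Qed.

End Pairs.

Section Defect.
Variables (A : comNzRingType) (M N : lmodType A) (J : set A).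
Local Notation P := (res0 M).
Local Notation PN := (res0 N).
Local Notation d0 := (@res_d0 A M).
Local Notation d1 := (@res_d1 A M).
Local Notation p := (@res_d0 A N).
Implicit Type f : res1 M -> N.

Let ld1 : linear d1 := @res_d1_linear A M.
Let lp : linear p := @res_d0_linear A N.

(* The kernel of res0 N * res0 M -> E for the extension E given by f. *)
Definition ext_syzygies f : set (PN * P)%type :=
  [set ab | exists x, d1 x = ab.2 /\ p ab.1 = f x].

(** For a cocycle f, modulo J ker p this is the kernel of Tor_1(N, A/J) -> Tor_1(E, A/J), that is,
    the image of Tor_2(M, A/J). *)
Definition defectN f : set PN := [set a | smul J (ext_syzygies f) (a, 0)].

(** For a cocycle f, the connecting map Tor_1(M, A/J) -> N/JN sends the class of b = d1 x to that of
    f x. Modulo J ker d0 this is its kernel, that is, the image of Tor_1(E, A/J). *)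
Definition defectM f : set P :=
  [set b | smul J setT b /\ exists x, d1 x = b /\ smul J setT (f x)].

(* l(Tor_1(M, A/J)) + l(Tor_1(N, A/J)) - l(Tor_1(E, A/J)): the two terms are the
   lengths of the images of the connecting maps from Tor_2(M, A/J) to
   Tor_1(N, A/J) and from Tor_1(M, A/J) to N/JN. *)
Definition defect f : nat :=
  (len (defectN f) (tor_boundaries p J) + len (tor_cycles d0 J) (defectM f))%N.

Section Cocycle.
Variable f : res1 M -> N.
Hypothesis lf : linear f.

Lemma submod_ext_syzygies : is_submod (ext_syzygies f).
Proof.
split.
- by exists 0; rewrite (lin0 ld1) (lin0 lp) (lin0 lf).
- move=> [a b] [a' b'] [x [/= xb xa]] [x' [/= xb' xa']]; exists (x + x') => /=.
  by rewrite (linD ld1) (linD lp) (linD lf) xb xb' xa xa'.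
- move=> c [a b] [x [/= xb xa]]; exists (c *: x) => /=.
  by rewrite (linZ ld1) (linZ lp) (linZ lf) xb xa.
Qed.

Lemma submod_defectN : is_submod (defectN f).
Proof. exact: (submod_preimage (@pairl_linear _ PN P) (smul_submod _ _)). Qed.

Lemma submod_defectM : is_submod (defectM f).
Proof.
have hJ (V : lmodType A) := @smul_submod A V J setT.
split.
- split; first exact: (submod0 (hJ _)).
  by exists 0; rewrite (lin0 ld1) (lin0 lf); split=> //; exact: (submod0 (hJ _)).
- move=> b b' [Jb [x [xb Jx]]] [Jb' [x' [xb' Jx']]].
  split; first exact: (submodD (hJ _)).
  by exists (x + x'); rewrite (linD ld1) (linD lf) xb xb'; split=> //; exact: (submodD (hJ _)).
- move=> c b [Jb [x [xb Jx]]]; split; first exact: (submodZ _ (hJ _)).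
  by exists (c *: x); rewrite (linZ ld1) (linZ lf) xb; split=> //; exact: (submodZ _ (hJ _)).
Qed.

Lemma tor_boundaries_defectN : tor_boundaries p J `<=` defectN f.
Proof.
move=> a; apply: (smul_linear (@pairl_linear _ PN P)) => l pl.
by exists 0; rewrite /= (lin0 ld1) (lin0 lf).
Qed.

Lemma defectM_cycles : defectM f `<=` tor_cycles d0 J.
Proof.
move=> b [Jb [x [xb _]]]; split=> //.
by rewrite -[ker _]range_res_d1; exists x.
Qed.

Hypothesis f_cocycle : forall y, f (res_d2 y) = 0.

Lemma cocycle_eq x x' : d1 x = d1 x' -> f x = f x'.
Proof.
move=> dx; have : ker d1 (x - x') by rewrite /ker /= (linB ld1) dx subrr.
rewrite -range_res_d2 => -[y _ yE]; apply/eqP.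
by rewrite -subr_eq0 -(linB lf) -yE f_cocycle.
Qed.

Lemma defectN_cycles : defectN f `<=` tor_cycles p J.
Proof.
move=> a Ja; split; last by case/smul_pair: (smulS (@subset_refl _ J) (@subsetT _ _) Ja).
have [x [/= xb pa]] := smul_sub submod_ext_syzygies Ja.
by rewrite /ker /= pa -(lin0 lf); apply: cocycle_eq; rewrite xb (lin0 ld1).
Qed.

Lemma boundaries_defectM : tor_boundaries d0 J `<=` defectM f.
Proof.
move=> b; rewrite /tor_boundaries -range_res_d1 -(image_smul _ _ ld1) => -[x Jx xb].
split; last by exists x; split=> //; apply: (smul_linear lf _ Jx).
by rewrite -xb; apply: (smul_linear ld1 _ Jx).
Qed.

End Cocycle.

(** Additivity of the connecting map from Tor_2, on syzygies: if a lifts f x, a syzygy (e, b) of f +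
    f' splits into (a, b) for f and (e - a, b) for f'. The second components of the terms of a
    J-combination vanish only in the sum, so S keeps track of them; having the same b on both sides
    makes both vanish together. *)
Lemma defectN_sub f f' : linear f -> linear f' ->
  defectN (f + f') `<=` sumset (defectN f) (defectN f').
Proof.
move=> lf lf'; have hJ := @smul_submod A (PN * P)%type J.
pose S : set (PN * P)%type := [set cb | exists a,
  smul J (ext_syzygies f) (a, cb.2) /\ smul J (ext_syzygies f') (cb.1 - a, cb.2)].
have hS : is_submod S.
  split.
  - by exists 0; rewrite subr0; split; exact: (submod0 (hJ _)).
  - move=> [c b] [c' b'] [a [Ja Ja']] [e [Je Je']]; exists (a + e) => /=.
    split; first exact: (submodD (hJ _) Ja Je).
    by rewrite opprD addrACA; exact: (submodD (hJ _) Ja' Je').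
  - move=> r [c b] [a [Ja Ja']]; exists (r *: a) => /=.
    split; first exact: (submodZ r (hJ _) Ja).
    by rewrite -scalerBr; exact: (submodZ r (hJ _) Ja').
move=> c Jc; suff [a [Ja Ja']] : S (c, 0) by exists a.
apply: (smul_min hS) Jc => j [e b] Jj [x [/= xb xe]].
have [a aE] := res_d0_surj (f x).
exists (j *: a); rewrite /= -scalerBr; split.
  by apply: (mem_smul (x := (a, b))) => //; exists x.
apply: (mem_smul (x := (e - a, b))) => //; exists x; split=> //=.
by rewrite (linB lp) xe aE /= addrC addKr.
Qed.

Lemma defectM_sub f f' : linear f -> linear f' ->
  (forall y, f' (res_d2 y) = 0) -> defectM f `&` defectM f' `<=` defectM (f + f').
Proof.
move=> lf lf' cf' b [[Jb [x [xb Jx]]] [_ [x' [xb' Jx']]]]; split=> //; exists x; split=> //.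
rewrite (cocycle_eq lf' cf' (_ : d1 x' = d1 x)) in Jx'; last by rewrite xb.
exact: (submodD (smul_submod _ _) Jx Jx').
Qed.

(** For a syzygy (e, b) of r f and a lift a of f x, the elements e and r a have the same image in N.
    So (e, b) is compared with the syzygy (a, b) of f, up to an error in ker p that J turns into a
    boundary. *)
Lemma defectN_scale f (r : A) : linear f -> defectN (r *: f) `<=` defectN f.
Proof.
move=> lf; have hJ := @smul_submod A (PN * P)%type J.
have hB := @smul_submod A PN J (ker p).
pose S : set (PN * P)%type := [set cb | exists a,
  smul J (ext_syzygies f) (a, cb.2) /\ tor_boundaries p J (cb.1 - r *: a)].
have hS : is_submod S.
  split.
  - by exists 0; rewrite scaler0 subr0; split; [exact: (submod0 (hJ _))|exact: (submod0 hB)].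
  - move=> [c b] [c' b'] [a [Ja Ja']] [e [Je Je']]; exists (a + e) => /=.
    split; first exact: (submodD (hJ _) Ja Je).
    by rewrite scalerDr opprD addrACA; exact: (submodD hB Ja' Je').
  - move=> s [c b] [a [Ja Ja']]; exists (s *: a) => /=.
    split; first exact: (submodZ s (hJ _) Ja).
    by rewrite scalerA mulrC -scalerA -scalerBr; exact: (submodZ s hB Ja').
move=> c Jc; have [a [Ja Bca]] : S (c, 0).
  apply: (smul_min hS) Jc => j [e b] Jj [x [/= xb xe]].
  have [a aE] := res_d0_surj (f x).
  exists (j *: a); rewrite /= scalerA mulrC -scalerA -scalerBr; split.
    by apply: (mem_smul (x := (a, b))) => //; exists x.
  by apply: mem_smul => //; rewrite /ker /= (linB lp) (linZ lp) xe aE subrr.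
rewrite -(subrK (r *: a) c); apply: (submodD (submod_defectN f)).
  exact: tor_boundaries_defectN.
exact: (submodZ r (submod_defectN f)).
Qed.

Lemma defectM_scale f (r : A) : defectM f `<=` defectM (r *: f).
Proof.
move=> b [Jb [x [xb Jx]]]; split=> //; exists x; split=> //.
exact: (submodZ r (smul_submod _ _)).
Qed.

Hypotheses (flM : flen (tor_cycles d0 J) (tor_boundaries d0 J))
  (flN : flen (tor_cycles p J) (tor_boundaries p J)).

Let ld0 : linear d0 := @res_d0_linear A M.
Let hZM := submod_tor_cycles J ld0.
Let hZN := submod_tor_cycles J lp.
Let hBN := @smul_submod A PN J (ker p).

Lemma linear_add f f' : linear f -> linear f' -> linear (f + f').
Proof. by move=> lf lf' a x y; rewrite !fctE lf lf' scalerDr addrACA. Qed.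

Lemma linear_scale f r : linear f -> linear (r *: f).
Proof.
move=> lf a x y; change (r *: f (a *: x + y) = a *: (r *: f x) + r *: f y).
by rewrite lf scalerDr !scalerA mulrC.
Qed.

Lemma defect0 : defect 0 = 0%N.
Proof.
have lz : linear (0 : res1 M -> N) 
  by move=> a x y; change (0 = a *: 0 + 0 :> N); rewrite scaler0 addr0.
have NE : defectN 0 = tor_boundaries p J.
  apply/seteqP; split; last exact: tor_boundaries_defectN.
  move=> a Ja; apply: (smul_linear (@fst_linear _ PN P) _ Ja) => -[c b] [x [_ /= cx]].
  by rewrite /ker /= cx.
have ME : defectM 0 = tor_cycles d0 J.
  apply/seteqP; split; first exact: defectM_cycles.
  move=> b [+ Jb]; rewrite -[ker _]range_res_d1 => -[x _ xb]; split=> //; exists x; split=> //.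
  exact: (submod0 (smul_submod _ _)).
by rewrite /defect NE ME !len_id.
Qed.

Lemma defectD f f' : linear f -> linear f' -> (forall y, f (res_d2 y) = 0) ->
  (forall y, f' (res_d2 y) = 0) -> (defect (f + f')%R <= defect f + defect f')%N.
Proof.
move=> lf lf' cf cf'; have lff := linear_add lf lf'.
have cff y : (f + f') (res_d2 y) = 0 by rewrite fctE cf cf' addr0.
rewrite /defect addnACA; apply: leq_add.
  apply: leq_trans (len_join hZN (submod_defectN f) (submod_defectN f') hBN
    (tor_boundaries_defectN lf) (tor_boundaries_defectN lf')
    (defectN_cycles lf cf) (defectN_cycles lf' cf') flN).
  apply: len_le => //.
  - exact: submod_defectN.
  - by apply: submod_sum; exact: submod_defectN.
  - exact: tor_boundaries_defectN.
  - exact: defectN_sub.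
  - apply: flen_sub hZN flN _ (@subset_refl _ _).
    by apply: sumset_min => //; exact: defectN_cycles.
have BI : tor_boundaries d0 J `<=` defectM f `&` defectM f'.
  by move=> b Bb; split; exact: boundaries_defectM.
have flI : flen (tor_cycles d0 J) (defectM f `&` defectM f').
  exact: flen_sub hZM flM (@subset_refl _ _) BI.
apply: leq_trans (len_meet hZM (submod_defectM lf) (submod_defectM lf')
  (@defectM_cycles f) (@defectM_cycles f') flI).
apply: len_le => //.
- exact: submod_defectM.
- exact: defectM_sub.
- exact: defectM_cycles.
Qed.

Lemma defectZ f r : linear f -> (forall y, f (res_d2 y) = 0) ->
  (defect (r *: f)%R <= defect f)%N.
Proof.
move=> lf cf; have lrf := linear_scale r lf; apply: leq_add.
  apply: len_le => //.
  - exact: submod_defectN.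
  - exact: submod_defectN.
  - exact: tor_boundaries_defectN.
  - exact: defectN_scale.
  - exact: flen_sub hZN flN (defectN_cycles lf cf) (@subset_refl _ _).
apply: len_le => //.
- exact: submod_defectM.
- exact: defectM_scale.
- exact: defectM_cycles.
- exact: flen_sub hZM flM (@subset_refl _ _) (boundaries_defectM lf).
Qed.

(** Tor_1(E, A/J) is computed from the cover q of E by the sum of the covers of N and M, whose
    kernel is [ext_syzygies f]. It is cut by Z1, the cycles whose second component is a boundary for
    M: above Z1 lies the image of Tor_1(E, A/J) in Tor_1(M, A/J), below it that of Tor_1(N, A/J) in
    Tor_1(E, A/J). *)
Lemma defectE (E : lmodType A) (i : N -> E) (o : E -> M) (g : P -> E) f :
  linear i -> linear o -> injective i -> range i = [set x | o x = 0] ->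
  (forall x, exists e, o e = x) -> linear g -> linear f ->
  (forall b, o (g b) = d0 b) -> (forall x, g (d1 x) = i (f x)) ->
  (len (tor_cycles p J) (tor_boundaries p J) + len (tor_cycles d0 J) (tor_boundaries d0 J) =
   len (tor_cycles (@res_d0 A E) J) (tor_boundaries (@res_d0 A E) J) + defect f)%N.
Proof.
move=> li lo inji io os lg lf og gi.
have oi n : o (i n) = 0 by have : range i (i n) by [exists n]; rewrite io.
have cf y : f (res_d2 y) = 0.
  apply: inji; rewrite -gi (lin0 li).
  have : range (@res_d2 A M) (res_d2 y) by exists y.
  by rewrite range_res_d2 => ->; exact: (lin0 lg).
pose q (ab : PN * P) : E := i (p ab.1) - g ab.2.
have lq : linear q.
  by move=> a x y; rewrite /q /= lp li lg opprD addrACA scalerBr.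
have qs e : exists x, q x = e.
  have [b ob] := res_d0_surj (o e).
  have : range i (e - g b) by rewrite io /= (linB lo) og ob subrr.
  move=> [n _ nE]; have [a an] := res_d0_surj n; exists (a, - b).
  by rewrite /q /= an nE (linN lg) opprK subrK.
have qker : ker q = ext_syzygies f.
  apply/seteqP; split=> [[a b] /eqP|[a b] [x [/= xb xa]]]; last first.
    by rewrite /ker /q /= -xb xa gi subrr.
  rewrite subr_eq0 /= => /eqP ipa.
  have : ker d0 b by rewrite /ker /= -og -ipa oi.
  rewrite -range_res_d1 => -[x _ xb]; exists x; split=> //=.
  by apply: inji; rewrite -gi xb.
have sl : same_len (tor_cycles (@res_d0 A E) J) (tor_boundaries (@res_d0 A E) J)
                  (tor_cycles q J) (tor_boundaries q J).
  apply: tor_cover => //.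
  - exact: projective_free.
  - by apply: projective_prod; exact: projective_free.
  - exact: res_d0_linear.
  - exact: res_d0_surj.
have hZ := submod_tor_cycles J lq.
have hBM := @smul_submod A P J (ker d0); have hB := @smul_submod A _ J (ker q).
pose Z1 := tor_cycles q J `&` snd @^-1` tor_boundaries d0 J.
have hZ1 : is_submod Z1.
  by apply: submodI => //; exact: (submod_preimage (@snd_linear _ PN P)).
have Z1Z : Z1 `<=` tor_cycles q J by move=> x [].
have BZ1 : tor_boundaries q J `<=` Z1.
  move=> x Bx; split; first exact: tor_boundaries_cycles.
  apply: (smul_linear (@snd_linear _ PN P) _ Bx) => -[a b]; rewrite qker => -[y [/= yb _]].
  by rewrite -range_res_d1; exists y.
have sM : same_len (tor_cycles q J) Z1 (defectM f) (tor_boundaries d0 J).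
  apply: (same_len_map (@snd_linear _ PN P)) => //.
  - exact: submod_defectM.
  - move=> [a b] [+ /smul_pair[Ja Jb]]; rewrite qker => -[x [/= xb xa]].
    split=> //; exists x; split=> //; rewrite -xa.
    by apply: (smul_linear lp _ Ja).
  - exact: boundaries_defectM.
  - move=> b [Jb [x [xb Jfx]]].
    have : smul J (range p) (f x).
      apply: smulS Jfx => // n _; have [a <-] := res_d0_surj n; by exists a.
    rewrite -(image_smul _ _ lp) => -[a Ja aE]; exists (a, b).
      split; last exact/smul_pair.
      by rewrite qker; exists x.
    by rewrite subrr; exact: (submod0 hBM).
have sN : same_len (tor_cycles p J) (defectN f) Z1 (tor_boundaries q J).
  apply: (same_len_map (@pairl_linear _ PN P)) => //.
  - move=> a [pa Ja]; split; last exact: (submod0 hBM).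
    split; last by apply/smul_pair; split=> //; exact: (submod0 (smul_submod _ _)).
    by rewrite qker; exists 0; rewrite /= (lin0 ld1) (lin0 lf).
  - move=> [a b] [[+ /smul_pair[Ja _]] /= Bb]; rewrite qker => syz_ab.
    (* Every element of ker d0 is the second component of a syzygy, so J ker d0 lifts to J times the
       syzygies, and (a, b) can be corrected by a boundary to have second component 0. *)
    have [[a' b'] Ba' /= bb] : (snd @` tor_boundaries q J) b.
      rewrite (image_smul _ _ (@snd_linear _ PN P)) qker; apply: smulS Bb => // c.
      rewrite -range_res_d1 => -[x _ xc]; have [e eE] := res_d0_surj (f x).
      by exists (e, c) => //; exists x.
    rewrite {}bb in Ba'; exists (a - a').
      split; last first.
        apply: (submodB (smul_submod _ _)) => //.
        by have /smul_pair[] := smulS (@subset_refl _ J) (@subsetT _ _) Ba'.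
      have [x [/= xb xa]] := syz_ab.
      have := smul_sub (submod_ker lq) Ba'; rewrite qker => -[x' [/= xb' xa']].
      by rewrite /ker /= (linB lp) xa xa' (cocycle_eq lf cf (_ : d1 x = d1 x')) ?subrr// xb.
    have -> : (a, b) - (a - a', 0) = (a', b) :> (PN * P)%type.
      by apply: injective_projections; rewrite /= ?subr0// subKr.
    by [].
  - by move=> a _; rewrite /tor_boundaries qker.
  - move=> a Da; split; first exact: defectN_cycles Da.
    by rewrite /tor_boundaries qker.
have flE : flen (tor_cycles q J) (tor_boundaries q J).
  apply: (flen_trans hZ1 BZ1 Z1Z hZ).
    by apply/sM.1; exact: flen_sub hZM flM (@defectM_cycles f) (@subset_refl _ _).
  by apply/sN.1; exact: flen_sub hZN flN (@subset_refl _ _) (tor_boundaries_defectN lf).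
rewrite sl.2 (lenD hZ hZ1 BZ1 Z1Z flE) sM.2 -sN.2.
rewrite (lenD hZN (submod_defectN f) (tor_boundaries_defectN lf) (defectN_cycles lf cf) flN).
rewrite (lenD hZM (submod_defectM lf) (boundaries_defectM lf) (@defectM_cycles f) flM).
by rewrite /defect; lia.
Qed.

End Defect.

(** * Extensions and T-split classes *)

Section Extensions.
Variables (A : comNzRingType) (M N : lmodType A).

Definition bundle_linear (V W : lmodType A) (f : V -> W) (lf : linear f) : {linear V -> W} :=
  HB.pack f (GRing.isLinear.Build A V W *:%R f lf).

Lemma fingen_extension (E : extension M N) : fingen [set: M] -> fingen [set: N] ->
  fingen [set: ext_mod E].
Proof.
move=> [sM sMT] [sN sNT]; have li : linear (ext_in E) by exact: linearP.
have lo : linear (ext_out E) by exact: linearP.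
have os x : exists e, ext_out E e = x.
  by have : range (ext_out E) x by [rewrite ext_out_surj]; move=> [e _ <-]; exists e.
have [l lE] := choice os.
exists (map (ext_in E) sN ++ map l sM); apply/seteqP; split=> // e _.
rewrite lspan_cat.
have imset (V W : lmodType A) (f : V -> W) (s : seq V) : [set` map f s] = f @` [set` s].
  by apply/seteqP; split=> [_ /mapP[x xs ->]|_ [x xs <-]]; [exists x|exact: map_f].
have : lspan [set` sM] (ext_out E e) by rewrite -sMT.
have {1}-> : sM = map (ext_out E) (map l sM).
  by rewrite -map_comp map_id_in// => x _ /=; rewrite lE.
rewrite (imset _ _ (ext_out E)) -image_lspan// => -[e' le' e'E].
have : range (ext_in E) (e - e') by rewrite ext_exact /= (linB lo) e'E subrr.
rewrite sNT image_lspan// -imset => ine; exists (e - e') => //.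
by rewrite opprB addrC subrK.
Qed.

Lemma ext_cocycle_submod : is_submod (@ext_cocycle A M N).
Proof.
split.
- split; first by move=> a x y; change (0 = a *: 0 + 0 :> N); rewrite scaler0 addr0.
  by apply/funext.
- move=> f f' [lf cf] [lf' cf']; split; first exact: linear_add.
  apply/funext => y; change (f (res_d2 y) + f' (res_d2 y) = 0 :> N).
  have := congr1 (fun h => h y) cf; have := congr1 (fun h => h y) cf'.
  by rewrite /= => -> ->; rewrite addr0.
- move=> r f [lf cf]; split; first exact: linear_scale.
  apply/funext => y; change (r *: f (res_d2 y) = 0 :> N).
  by have := congr1 (fun h => h y) cf; rewrite /= => ->; rewrite scaler0.
Qed.

Lemma cocycleP (f : submod (@ext_cocycle A M N)) :
  linear (val f) /\ forall y, val f (res_d2 y) = 0.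
Proof.
have : ext_cocycle (val f).
  by have := valP f; move=> /asboolP; rewrite lspan_id//; exact: ext_cocycle_submod.
by move=> [lf cf]; split=> // y; exact: (congr1 (fun h => h y) cf).
Qed.

Section Pushout.
Variable f : res1 M -> N.
Hypotheses (lf : linear f) (cf : forall y, f (res_d2 y) = 0).

Definition pushout_rel : set (N * res0 M)%type :=
  range (fun x : res1 M => (f x, - res_d1 x)).

Let ld1 := @res_d1_linear A M.
Let ld0 := @res_d0_linear A M.

Lemma pushout_rel_submod : is_submod pushout_rel.
Proof.
apply: submod_image; last exact: submodT.
move=> a x y; apply: injective_projections; first exact: lf.
by rewrite /= ld1 opprD scalerN.
Qed.

Definition pushout : lmodType A := quotmod pushout_rel.

Definition pushout_in (n : N) : pushout := \pi_(quotmod pushout_rel) (n, 0).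

Definition pushout_out (e : pushout) : M := res_d0 (repr e).2.

Definition pushout_lift (b : res0 M) : pushout := \pi_(quotmod pushout_rel) (0, b).

Let lpi := @quotmod_pi_linear A _ pushout_rel.

Lemma pushout_in_linear : linear pushout_in.
Proof. by move=> a x y; rewrite /pushout_in (@pairl_linear A N (res0 M)) lpi. Qed.

Lemma pushout_lift_linear : linear pushout_lift.
Proof. by move=> a x y; rewrite /pushout_lift (@pairr_linear A N (res0 M)) lpi. Qed.

Lemma pushout_out_pi u : pushout_out (\pi_(quotmod pushout_rel) u) = res_d0 u.2.
Proof.
apply: (@quotmod_lift A _ M pushout_rel (fun u => res_d0 u.2)).
  by move=> a x y; rewrite /= ld0.
move=> _ [x _ <-] /=; rewrite (linN ld0).
have : range (@res_d1 A M) (res_d1 x) by exists x.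
by rewrite range_res_d1 => ->; rewrite oppr0.
Qed.

Lemma pushout_out_linear : linear pushout_out.
Proof.
move=> a; elim/quotW => x; elim/quotW => y.
by rewrite -lpi !pushout_out_pi ld0.
Qed.

Lemma pushout_in_inj : injective pushout_in.
Proof.
move=> n n' /quotmod_piP; rewrite lspan_id; last exact: pushout_rel_submod.
move=> [x _ [fx /= dx]]; apply/eqP; rewrite -subr_eq0 -fx.
have : ker (@res_d1 A M) x.
  by rewrite /ker /=; apply/eqP; rewrite -oppr_eq0 dx subrr.
by rewrite -range_res_d2 => -[y _ <-]; rewrite cf.
Qed.

Lemma pushout_exact : range pushout_in = [set e | pushout_out e = 0].
Proof.
apply/seteqP; split=> [_ [n _ <-]|]; first by rewrite /= pushout_out_pi (lin0 ld0).
elim/quotW => -[n b] /=; rewrite pushout_out_pi /= => db.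
have : ker (@res_d0 A M) b by [].
rewrite -range_res_d1 => -[x _ xb]; exists (n + f x) => //.
apply/quotmod_piP; rewrite lspan_id; last exact: pushout_rel_submod.
exists x => //; apply: injective_projections => /=; first by rewrite addrAC subrr add0r.
by rewrite xb sub0r.
Qed.

Lemma pushout_out_surj : range pushout_out = setT.
Proof.
apply/seteqP; split=> // x _; have [b bE] := res_d0_surj x.
by exists (pushout_lift b) => //; rewrite pushout_out_pi.
Qed.

Definition pushout_extension : extension M N :=
  @Extension A M N pushout (bundle_linear pushout_in_linear)
    (bundle_linear pushout_out_linear) pushout_in_inj pushout_exact pushout_out_surj.

End Pushout.

(** The way back from cocycles to extensions: to show a class T-split, an actual extension
    representing it is required. The pushout of f along d1 provides one. *)
Lemma exists_extension (f : submod (@ext_cocycle A M N)) :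
  exists (E : extension M N) (g : res0 M -> ext_mod E),
    [/\ linear g, ext_out E \o g = @res_d0 A M & g \o @res_d1 A M = ext_in E \o val f].
Proof.
have [lf cf] := cocycleP f; exists (pushout_extension lf cf), (@pushout_lift (val f)); split.
- exact: pushout_lift_linear.
- by apply/funext => b; rewrite /= pushout_out_pi.
apply/funext => x /=; apply/quotmod_piP; rewrite lspan_id; last exact: pushout_rel_submod.
exists (- x) => //; have ld1 := @res_d1_linear A M.
apply: injective_projections => /=; first by rewrite (linN lf) sub0r.
by rewrite (linN ld1) opprK subr0.
Qed.

End Extensions.

(** * Limits of the normalised lengths and T-split classes *)

Section TSplitting.
Variables (R : realType) (A : comNzRingType) (m : set A) (d : nat)
  (I : set A) (F : int -> set A).
Hypotheses (A_local : noetherian_local m) (A_CM : cohen_macaulay m)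
  (A_dim : krull_dim A d) (d_ge1 : (1 <= d)%N) (I_primary : primary_to m I)
  (F_admissible : admissible I F).

Definition tor_length (U : lmodType A) (n : nat) : nat :=
  len (tor_cycles (@res_d0 A U) (F n%:Z)) (tor_boundaries (@res_d0 A U) (F n%:Z)).

Lemma same_len_cover (U : lmodType A) k (q : {freeg 'I_k / A} -> U) (J : set A) :
  linear q -> (forall u, exists x, q x = u) ->
  same_len (tor_cycles q J) (tor_boundaries q J)
    (tor_cycles (@res_d0 A U) J) (tor_boundaries (@res_d0 A U) J).
Proof.
move=> lq qs; apply: tor_cover => //.
- exact: projective_free.
- exact: projective_free.
- exact: res_d0_linear.
- exact: res_d0_surj.
Qed.

Lemma flen_tor (U : lmodType A) n : fingen [set: U] ->
  flen (tor_cycles (@res_d0 A U) (F n%:Z)) (tor_boundaries (@res_d0 A U) (F n%:Z)).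
Proof.
move=> /fingen_cover[k [q [lq qs]]]; apply/(same_len_cover (F n%:Z) lq qs).1.
exact: (flen_tor_filtration A_local I_primary F_admissible (fingen_free A k) (submod_ker lq)).
Qed.

Lemma polyfun_tor_length (U : lmodType A) : fingen [set: U] ->
  polyfun d (fun n => (tor_length U n)%:R : R).
Proof.
move=> /fingen_cover[k [q [lq qs]]].
have := polyfun_tor_filtration R A_local A_CM A_dim d_ge1 I_primary F_admissible
  (fingen_free A k) (submod_ker lq).
apply: polyfun_ext; exists 0%N => n _; congr _%:R.
exact: (same_len_cover (F n%:Z) lq qs).2.
Qed.

Definition eT_coef (n : nat) : R := (d.-1)`!%:R / n%:R ^+ d.-1.

Lemma eT_coef_ge0 n : 0 <= eT_coef n.
Proof. by rewrite divr_ge0// exprn_ge0. Qed.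

Lemma fine_length_tor1 (U : lmodType A) n : fingen [set: U] ->
  fine (module_length (Tor1 U (@quotmod A A^o (F n%:Z))) R) = (tor_length U n)%:R.
Proof.
move=> fU; have hF : is_ideal (F n%:Z) by case: F_admissible.
have sl := tor1_length U hF.
by rewrite fine_module_length; [rewrite sl.2|apply/sl.1; exact: flen_tor].
Qed.

(** Since [lim] also has a value on divergent sequences, convergence must be known before values of
    [eT] can be compared by arithmetic of limits. It holds because the length grows with degree at
    most d - 1, the exponent of the normalisation. *)
Lemma eT_cvg (U : lmodType A) : fingen [set: U] ->
  (fun n => eT_coef n * (tor_length U n.+1)%:R) @ \oo --> eT R d F U.
Proof.
move=> fU; have -> : eT R d F U = limn (fun n => eT_coef n * (tor_length U n.+1)%:R).
  rewrite /eT; congr (lim (_ @ \oo)); apply/funext => n.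
  exact: (congr1 (fun x => eT_coef n * x) (fine_length_tor1 n.+1 fU)).
suff : cvgn (fun n => eT_coef n * (tor_length U n.+1)%:R) by [].
have := polyfun_shift (polyfun_tor_length fU); rewrite /eT_coef.
case: d d_ge1 => [//|d'] _ /polyfun_cvg /= cv.
have -> : (fun n => (d'`!%:R / n%:R ^+ d') * (tor_length U n.+1)%:R : R) =
    (fun n => d'`!%:R * ((tor_length U n.+1)%:R / n%:R ^+ d')).
  by apply/funext => n; rewrite mulrAC mulrA.
by have /cvg_ex[l hl] := cv; apply/cvg_ex; exists (d'`!%:R * l); exact: cvgMr hl.
Qed.

Section Split.
Variables (M N : lmodType A).
Hypotheses (fM : fingen [set: M]) (fN : fingen [set: N]).

Definition defect_seq (f : res1 M -> N) (n : nat) : R :=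
  eT_coef n * (defect (F n.+1%:Z) f)%:R.

Lemma eT_ext_cvg (E : extension M N) (g : res0 M -> ext_mod E)
    (f : submod (@ext_cocycle A M N)) : linear g -> ext_out E \o g = @res_d0 A M ->
  g \o @res_d1 A M = ext_in E \o val f ->
  defect_seq (val f) @ \oo --> eT_ext R d F E.
Proof.
move=> lg og gi; have [lf cf] := cocycleP f.
have fE := fingen_extension E fM fN.
apply: cvg_trans (cvgB (cvgD (eT_cvg fM) (eT_cvg fN)) (eT_cvg fE)); apply: near_eq_cvg.
apply: nearW => n; rewrite /defect_seq.
have li : linear (ext_in E) by exact: linearP.
have lo : linear (ext_out E) by exact: linearP.
have os x : exists e, ext_out E e = x.
  by have : range (ext_out E) x by [rewrite ext_out_surj]; move=> [e _ <-]; exists e.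
have := defectE (flen_tor n.+1 fM) (flen_tor n.+1 fN) li lo (@ext_in_inj _ _ _ E)
  (ext_exact E) os lg lf (fun b => congr1 (fun h => h b) og) (fun x => congr1 (fun h => h x) gi).
rewrite -!/(tor_length _ _) => lE.
have {}lE : (tor_length N n.+1)%:R + (tor_length M n.+1)%:R =
    (tor_length (ext_mod E) n.+1)%:R + (defect (F n.+1%:Z) (val f))%:R :> R.
  by rewrite -!natrD lE.
change (eT_coef n * (tor_length M n.+1)%:R + eT_coef n * (tor_length N n.+1)%:R -
  eT_coef n * (tor_length (ext_mod E) n.+1)%:R = eT_coef n * (defect (F n.+1%:Z) (val f))%:R).
by rewrite -mulrDr -mulrBr [(tor_length M _)%:R + _]addrC lE addrAC subrr add0r.
Qed.

(** By [eT_ext_cvg] the limit of the defects of f is e^T of every extension that f represents.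
    T-splitness can thus be tested on a cocycle, and sums and multiples of cocycles are pointwise,
    with no Baer sum of extensions. *)
Lemma T_splitP (alpha : Ext1 M N) : T_split R d F alpha <->
  exists2 f : submod (@ext_cocycle A M N), alpha = \pi f &
    defect_seq (val f) @ \oo --> (0 : R).
Proof.
split=> [[E [g [f [lg og gi fE]]] eE]|[f -> f0]].
  by exists f => //; rewrite -eE; exact: eT_ext_cvg lg og gi.
have [E [g [lg og gi]]] := exists_extension f.
exists E; first by exists g, f.
exact: (cvg_unique (@Rhausdorff R) (eT_ext_cvg lg og gi) f0).
Qed.

Lemma defect_seq_le (u : nat -> R) (f : res1 M -> N) : u @ \oo --> (0 : R) ->
  (forall n, defect_seq f n <= u n) -> defect_seq f @ \oo --> (0 : R).
Proof.
move=> u0 fu; apply: (@squeeze_cvgr _ _ _ _ (fun=> 0) u) => //; last exact: cvg_cst.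
by apply: nearW => n; rewrite fu mulr_ge0// eT_coef_ge0.
Qed.

Lemma submod_T_split : is_submod (T_split R d F (M := M) (N := N)).
Proof.
have lpi := @quotmod_pi_linear A (submod (@ext_cocycle A M N))
  [set z | ext_coboundary (val z)].
have flM n := flen_tor n fM; have flN n := flen_tor n fN.
split.
- apply/T_splitP; exists 0; first by rewrite -(lin0 lpi).
  have -> : defect_seq (val (0 : submod (@ext_cocycle A M N))) = fun=> 0.
    by apply/funext => n; rewrite /defect_seq defect0 mulr0.
  exact: cvg_cst.
- move=> _ _ /T_splitP[f -> f0] /T_splitP[f' -> f'0].
  have [lf cf] := cocycleP f; have [lf' cf'] := cocycleP f'.
  apply/T_splitP; exists (f + f'); first by rewrite -(linD lpi).
  apply: (@defect_seq_le (defect_seq (val f) + defect_seq (val f'))).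
    by rewrite -[0]addr0; exact: cvgD.
  move=> n; change (defect_seq (val f + val f') n <= defect_seq (val f) n + defect_seq (val f') n).
  rewrite /defect_seq -mulrDr -natrD; apply: ler_wpM2l; first exact: eT_coef_ge0.
  by rewrite ler_nat; exact: (defectD (flM _) (flN _)).
- move=> r _ /T_splitP[f -> f0]; have [lf cf] := cocycleP f.
  apply/T_splitP; exists (r *: f); first by rewrite -(linZ lpi).
  apply: (defect_seq_le f0) => n.
  change (defect_seq (r *: val f) n <= defect_seq (val f) n).
  rewrite /defect_seq; apply: ler_wpM2l; first exact: eT_coef_ge0.
  by rewrite ler_nat; exact: (defectZ (flM _) (flN _) r lf cf).
Qed.

End Split.

End TSplitting.

Theorem theorem4p1 (R : realType) (A : comNzRingType) (m : set A) (d : nat)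
    (I : set A) (F : int -> set A) (M N : lmodType A)
    (A_local : noetherian_local m)
    (A_unramified : analytically_unramified m)
    (A_CM : cohen_macaulay m)
    (A_dim : krull_dim A d)
    (d_ge1 : (1 <= d)%N)
    (I_primary : primary_to m I)
    (F_admissible : admissible I F)
    (F_1 : F 1 = integral_closure I)
    (F_n : \forall n \near \oo, F n%:Z = integral_closure (ideal_exp I n))
    (M_MCM : maximal_cohen_macaulay M m)
    (N_MCM : maximal_cohen_macaulay N m) :
  is_submod (T_split R d F (M := M) (N := N)).
Proof.
case: M_MCM N_MCM => fM _ [fN _].
exact: (submod_T_split R A_local A_CM A_dim d_ge1 I_primary F_admissible fM fN).
Qed.
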